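(* Let $d \ge 1$ be an integer, $s>0$ and $L>0$. There are constants $c_1 > 0$ depending only on $(d,L)$ and $c_2 > 0$ depending only on $(s,d,L)$ such that the following holds for every integer $m \ge 1$ and every $a \ge 1$. Let $\kappa = \lfloor m^{2/(4s+d)} \rfloor$ (ordinary integer part), $\tau = 2m + a m \kappa^{-d/2}$, and let $\phi_{\kappa,\tau} = \mathbb{I}\{\Gamma_\kappa > \tau\}$, where $\Gamma_\kappa = \sum_{k \in [\kappa]^d} (M_{k,\kappa} - N_{k,\kappa})^2$ is the two-sample chi-squared statistic based on two samples of the same size $m$. Then $$R_\varepsilon^{(m,m)}(\phi_{\kappa,\tau}; \mathcal{H}_s^d(L)) \le c_1/a^2, \quad \text{if } \varepsilon \ge c_2\, a\, m^{-2s/(4s+d)}.$$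
   Context: Hölder class: for $s>0$, in the definition of the class (only), $\lfloor s \rfloor$ denotes the largest integer strictly smaller than $s$. $\mathcal{H}_s^d(L)$ is the class of functions $f:[0,1]^d \to \mathbb{R}$ having a derivative $f^{(\lfloor s\rfloor)}$ of order $\lfloor s \rfloor$ with $|f^{(\lfloor s \rfloor)}(x) - f^{(\lfloor s \rfloor)}(y)| \le L\|x-y\|^{s-\lfloor s\rfloor}$ for all $x,y\in[0,1]^d$, and such that $\|f^{(s')}\|_\infty \le L$ for all $s' \in \{0,\dots,\lfloor s\rfloor\}$. Here $f^{(k)}$ is the $k$-th order (multilinear) derivative, measured in operator norm, with $f^{(0)} = f$. Two-sample problem with equal sample sizes: $X_1,\dots,X_m$ are i.i.d. with density $f$ and, independently, $Y_1,\dots,Y_m$ are i.i.d. with density $g$, densities being with respect to Lebesgue measure $\nu$ on $[0,1]^d$. $[\kappa] = \{1,\dots,\kappa\}$, and for $k \in [\kappa]^d$ the bin counts are $M_{k,\kappa} = \#\{i : X_i \in ((k-1)/\kappa, k/\kappa]\}$ and $N_{k,\kappa} = \#\{j : Y_j \in ((k-1)/\kappa, k/\kappa]\}$, where $((k-1)/\kappa,k/\kappa] = \prod_{l=1}^d ((k_l-1)/\kappa, k_l/\kappa]$. A test $\phi$ is a Borel measurable function of the data with values in $[0,1]$, giving the probability of rejecting the null hypothesis $f=g$. $\mathbb{E}_{f,g}^{(m,m)}$ denotes expectation under this model. Let $\delta(f,g) = \|f-g\|_2 = (\int (f-g)^2\,d\nu)^{1/2}$. The worst-case risk of $\phi$ over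 a class $\mathcal{H}$ is $$R_\varepsilon^{(m,m)}(\phi;\mathcal{H}) = \sup\{\mathbb{E}^{(m,m)}_{f,f}[\phi] : f \in \mathcal{H}\} + \sup\{\mathbb{E}^{(m,m)}_{f,g}[1-\phi] : f,g \in \mathcal{H},\ \delta(f,g) \ge \varepsilon\},$$ where the suprema are over those $f,g$ that are probability densities, with the supremum over the empty set equal to $0$. *)

(* Defs.v *)
From HB Require Import structures.
From mathcomp Require Import all_boot all_order all_algebra.
From mathcomp Require Import all_classical all_reals all_analysis.
From mathcomp Require Import measurable_realfun.

Set Implicit Arguments.
Unset Strict Implicit.
Unset Printing Implicit Defensive.

Import Order.TTheory GRing.Theory Num.Theory.
Import numFieldNormedType.Exports.

Local Open Scope classical_set_scope.
Local Open Scope ring_scope.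

Section tuple_measure.
Context {disp : measure_display} {T : measurableType disp} {R : realType}.
Variable mu : {sigma_finite_measure set T -> \bar R}.

Definition cons_pair n (z : T * n.-tuple T) : n.+1.-tuple T :=
  [tuple of z.1 :: z.2].

Lemma measurable_cons_pair n : measurable_fun setT (@cons_pair n).
Proof. exact: measurable_cons. Qed.

Section step.
Variables (n : nat) (nu : {sigma_finite_measure set (n.-tuple T) -> \bar R}).

Definition cons_measure : set (n.+1.-tuple T) -> \bar R :=
  pushforward (mu \x nu)%E (@cons_pair n).

Let mu_nu : {measure set (T * n.-tuple T) -> \bar R} := (mu \x nu)%E.

Let cons_measure0 : cons_measure set0 = 0%E.
Proof. by rewrite /cons_measure /pushforward preimage_set0 (measure0 mu_nu). Qed.

Let cons_measure_ge0 A : (0 <= cons_measure A)%E.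
Proof. exact: (measure_ge0 mu_nu). Qed.

Let cons_measure_sigma_additive : semi_sigma_additive cons_measure.
Proof.
move=> F mF tF mUF; rewrite /cons_measure /pushforward preimage_bigcup.
have mp B : measurable B -> measurable (@cons_pair n @^-1` B).
  by move=> mB; rewrite -[X in measurable X]setTI; exact: measurable_cons_pair.
apply: (@measure_semi_sigma_additive _ _ _ mu_nu).
- by move=> k; exact: mp.
- apply/trivIsetP => /= i j _ _ ij; rewrite -preimage_setI.
  by move/trivIsetP : tF => /(_ _ _ _ _ ij) ->//; rewrite preimage_set0.
- by rewrite -preimage_bigcup; exact: mp.
Qed.

HB.instance Definition _ := isMeasure.Build _ _ _ cons_measure
  cons_measure0 cons_measure_ge0 cons_measure_sigma_additive.

Let cons_measure_sigma_finite : sigma_finite setT cons_measure.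
Proof.
have /sigma_finiteP[F [FT ndF Ffin]] := sigma_finiteT mu.
have /sigma_finiteP[G [GT ndG Gfin]] := sigma_finiteT nu.
pose g (x : n.+1.-tuple T) : T * n.-tuple T := (thead x, [tuple of behead x]).
have gK : cancel (@cons_pair n) g.
  by move=> [x t]; rewrite /g /cons_pair /= theadE; congr pair; apply/val_inj.
have mg : measurable_fun setT g.
  by apply/measurable_fun_pair; [exact: measurable_tnth|exact: measurable_behead].
exists (fun k => g @^-1` (F k `*` G k)).
  rewrite -preimage_bigcup [X in _ @^-1` X](_ : _ = setT) ?preimage_setT//.
  rewrite predeqE => -[x y]; split=> // _.
  have [i _ Fi] : (\bigcup_i F i) x by rewrite -FT.
  have [j _ Gj] : (\bigcup_i G i) y by rewrite -GT.
  exists (maxn i j) => //; split=> /=.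
  - by move: x Fi; exact/subsetPset/ndF/leq_maxl.
  - by move: y Gj; exact/subsetPset/ndG/leq_maxr.
move=> k; have [mF Fk] := Ffin k; have [mG Gk] := Gfin k; split.
  by rewrite -[X in measurable X]setTI; apply: mg => //; exact: measurableX.
rewrite /cons_measure /pushforward -comp_preimage.
rewrite (_ : g \o _ = id); last by apply/funext => z /=; rewrite gK.
by rewrite preimage_id product_measure1E// lte_mul_pinfty// ge0_fin_numE.
Qed.

HB.instance Definition _ := Measure_isSigmaFinite.Build _ _ _ cons_measure
  cons_measure_sigma_finite.

End step.

Fixpoint tuple_measure n : {sigma_finite_measure set (n.-tuple T) -> \bar R} :=
  match n with
  | 0 => \d_([tuple] : 0.-tuple T)
  | k.+1 => cons_measure (tuple_measure k)
  end.

End tuple_measure.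

Section iid.
Context {disp : measure_display} {T : measurableType disp} {R : realType}.
Variable P : probability T R.

Definition iid n : set (n.-tuple T) -> \bar R := tuple_measure P n.
Arguments iid n _ : clear implicits.

HB.instance Definition _ n := Measure.on (iid n).

Let iid_setT n : iid n setT = 1%E.
Proof.
rewrite /iid; elim: n => [|n IHn] /=; first by rewrite diracT.
rewrite /cons_measure /pushforward preimage_setT -setXTT product_measure1E//.
by rewrite IHn mule1; exact: (probability_setT P).
Qed.

HB.instance Definition _ n :=
  Measure_isProbability.Build _ _ _ (iid n) (@iid_setT n).

End iid.
Arguments iid {disp T R} P n _.

Section densities.
Context {R : realType}.
Variable d : nat.

Local Notation point := (d.-tuple (measurableTypeR R)).

Definition lebesgue_tuple : {sigma_finite_measure set point -> \bar R} :=
  tuple_measure (@lebesgue_measure R) d.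

Definition cube : set point := [set x | forall i, 0 <= tnth x i <= 1].

Lemma measurable_cube : measurable cube.
Proof.
rewrite (_ : cube =
    \big[setI/setT]_(i < d) ((@tnth d (measurableTypeR R))^~ i @^-1` `[0, 1]%classic)).
  apply: bigsetI_measurable => i _; rewrite -[X in measurable X]setTI.
  exact: measurable_tnth.
rewrite -bigcap_seq; apply/seteqP; split=> x /= H i.
  by move=> _; rewrite /= in_itv /=.
by have := H i (mem_index_enum i); rewrite /= in_itv.
Qed.

(* Functions on [0,1]^d are represented by total functions on R^d, of
   which only the values on the cube are ever used. *)
Record density := Density {
  pdf :> point -> R ;
  measurable_pdf : measurable_fun cube pdf ;
  pdf_ge0 : forall x, cube x -> 0 <= pdf x ;
  integral_pdf : (\int[lebesgue_tuple]_(x in cube) (pdf x)%:E = 1)%E }.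

Section law.
Variable p : density.

Definition law (A : set point) : \bar R :=
  (\int[lebesgue_tuple]_(x in A `&` cube) (p x)%:E)%E.

Let law0 : law set0 = 0%E.
Proof. by rewrite /law set0I integral_set0. Qed.

Let law_ge0 A : (0 <= law A)%E.
Proof. by apply: integral_ge0 => x [_ cx]; rewrite lee_fin pdf_ge0. Qed.

Let law_sigma_additive : semi_sigma_additive law.
Proof.
move=> /= F mF tF mUF; rewrite /law; apply: cvg_toP.
  apply: ereal_nondecreasing_is_cvgn => m n mn.
  apply: lee_sum_nneg_natr => // k _ _; exact: law_ge0.
rewrite setI_bigcupl ge0_integral_bigcup//=.
- by move=> i; apply: measurableI => //; exact: measurable_cube.
- apply/measurable_EFinP.
  apply: measurable_funS (measurable_pdf p); first exact: measurable_cube.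
  by move=> x [i _ []].
- by move=> x [i _ [_ cx]]; rewrite lee_fin pdf_ge0.
- exact: trivIset_setIr.
Qed.

HB.instance Definition _ := isMeasure.Build _ _ _ law
  law0 law_ge0 law_sigma_additive.

Let law_setT : law setT = 1%E.
Proof. by rewrite /law setTI integral_pdf. Qed.

HB.instance Definition _ := Measure_isProbability.Build _ _ _ law law_setT.

End law.

Definition l2dist (f g : point -> R) : \bar R :=
  ((\int[lebesgue_tuple]_(x in cube) ((f x - g x) ^+ 2)%:E) `^ 2^-1)%E.

End densities.
Arguments cube {R} d.
Arguments density R d : clear implicits.

Section holder.
Context {R : realType}.
Variable d : nat.

Local Notation point := (d.-tuple (measurableTypeR R)).

Definition enorm (v : 'rV[R]_d) : R := Num.sqrt (\sum_(i < d) v 0 i ^+ 2).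

Definition vec (x : point) : 'rV[R]_d := \row_i tnth x i.

Definition multilinear k (A : k.-tuple 'rV[R]_d -> R) : Prop :=
  forall (i : 'I_k) (v : k.-tuple 'rV[R]_d) (c : R) (u w : 'rV[R]_d),
    let subst h := [tuple if j == i then h else tnth v j | j < k] in
    A (subst (c *: u + w)) = c * A (subst u) + A (subst w).

Definition opnorm k (A : k.-tuple 'rV[R]_d -> R) : \bar R :=
  ereal_sup [set `|A v|%:E | v in
    [set v : k.-tuple 'rV[R]_d | forall i, enorm (tnth v i) <= 1]].

(* F k x is the k-th derivative of f at x for k <= n: each F k is Frechet
   differentiable relative to the cube, with derivative
   h |-> F k.+1 x (h, -) at x.  As the cube is convex with nonempty interior,
   f determines F k x for k <= n and x in the cube. *)
Definition is_derivatives (n : nat) (f : point -> R)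
    (F : forall k, point -> k.-tuple 'rV[R]_d -> R) : Prop :=
  [/\ forall x, cube d x -> F 0%N x [tuple] = f x,
      forall k x, (k <= n)%N -> cube d x -> multilinear (F k x) &
      forall k x, (k < n)%N -> cube d x -> forall e : R, 0 < e ->
        exists2 r : R, 0 < r & forall y, cube d y ->
          let h := vec y - vec x in
          enorm h < r ->
          (opnorm (fun v => F k y v - F k x v - F k.+1 x [tuple of h :: v])%R
             <= (e * enorm h)%:E)%E].

(* The largest integer strictly smaller than s, for s > 0. *)
Definition strict_floor (s : R) : nat := `|Num.ceil s|%N.-1.

Lemma strict_floorP (s : R) : 0 < s ->
  (strict_floor s)%:R < s <= (strict_floor s).+1%:R.
Proof.
move=> s0; have c0 : 0 < Num.ceil s by rewrite ceil_gt0.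
rewrite /strict_floor; case E : (Num.ceil s) c0 => [[|n]|n] // _ /=.
have := ceil_itv s; rewrite E.
by rewrite (_ : n.+1%:Z - 1 = n)// -addn1 PoszD addrK.
Qed.

Definition holder (s L : R) : set (point -> R) := [set f |
  let n := strict_floor s in
  exists F : forall k, point -> k.-tuple 'rV[R]_d -> R,
  [/\ is_derivatives n f F,
      forall x y, cube d x -> cube d y ->
        (opnorm (fun v => F n x v - F n y v)%R
           <= (L * enorm (vec x - vec y) `^ (s - n%:R))%:E)%E &
      forall k x, (k <= n)%N -> cube d x -> (opnorm (F k x) <= L%:E)%E]].

End holder.
Arguments holder {R} d s L.

Section two_sample.
Context {R : realType}.
Variables d m : nat.

Local Notation point := (d.-tuple (measurableTypeR R)).

Local Notation sample := (m.-tuple point * m.-tuple point)%type.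

Record test := Test {
  test_fun :> sample -> R ;
  measurable_test : measurable_fun setT test_fun ;
  test_itv : forall z, 0 <= test_fun z <= 1 }.

Definition two_sample_law (p q : density R d) : probability sample R :=
  (iid (law p) m \x iid (law q) m)%E.

(* All expectations below are nonnegative: adjoining 0 makes the supremum over
   the empty set equal to 0. *)
Definition risk (H : set (point -> R)) (eps : R) (phi : test) : \bar R :=
  (ereal_sup (0 |` [set 'E_(two_sample_law p p)[phi] |
                     p in [set p : density R d | H p]]) +
   ereal_sup (0 |` [set 'E_(two_sample_law pq.1 pq.2)[(fun z => 1 - phi z)%R] |
                     pq in [set pq : density R d * density R d |
                       [/\ H pq.1, H pq.2 & eps%:E <= l2dist pq.1 pq.2]]]))%E.

Section chi_squared.
Variable kappa : nat.

(* [kappa] is indexed from 0: k l here stands for k_l - 1. *)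
Definition in_bin (k : {ffun 'I_d -> 'I_kappa}) (x : point) : bool :=
  [forall l, (k l)%:R / kappa%:R < tnth x l <= (k l).+1%:R / kappa%:R].

Definition bin_count (k : {ffun 'I_d -> 'I_kappa}) (X : m.-tuple point)
  : nat := count (in_bin k) X.

Definition chi_squared (z : sample) : R :=
  \sum_(k : {ffun 'I_d -> 'I_kappa})
    ((bin_count k z.1)%:R - (bin_count k z.2)%:R) ^+ 2.

Lemma measurable_in_bin k : measurable_fun setT (in_bin k).
Proof.
rewrite (_ : in_bin k = fun x => \big[andb/true]_(l < d)
    ((k l)%:R / kappa%:R < tnth x l <= (k l).+1%:R / kappa%:R)); last first.
  by apply/funext => x; rewrite big_andE.
elim: (index_enum _) => [|l r IHr].
  by under eq_fun do rewrite big_nil; exact: measurable_cst.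
under eq_fun do rewrite big_cons.
apply: measurable_and => //; apply: measurable_and.
  by apply: measurable_fun_ltr => //; exact: measurable_tnth.
by apply: measurable_fun_ler => //; exact: measurable_tnth.
Qed.

Lemma measurable_bin_count k :
  measurable_fun setT (fun X => (bin_count k X)%:R : R).
Proof.
rewrite (_ : (fun X => _) = fun X : m.-tuple point =>
    \sum_(i < m) (if in_bin k (tnth X i) then 1 else 0)); last first.
  apply/funext => X; rewrite /bin_count -sum1_count natr_sum big_mkcond.
  by rewrite big_tuple.
apply: measurable_sum => i; apply: measurable_fun_ifT => //.
apply: (measurableT_comp (measurable_in_bin k)); exact: measurable_tnth.
Qed.

Lemma measurable_chi_squared : measurable_fun setT chi_squared.
Proof.
apply: measurable_sum => k; apply: measurable_funX; apply: measurable_funB.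
  exact: (measurableT_comp (measurable_bin_count k)).
exact: (measurableT_comp (measurable_bin_count k)).
Qed.

End chi_squared.

Definition chi_squared_test_fun (kappa : nat) (tau : R) (z : sample) : R :=
  (tau < chi_squared kappa z)%R%:R.

Lemma measurable_chi_squared_test_fun kappa tau :
  measurable_fun setT (chi_squared_test_fun kappa tau).
Proof.
rewrite (_ : chi_squared_test_fun kappa tau = fun z =>
    if tau < chi_squared kappa z then 1 else 0); last first.
  by apply/funext => z; rewrite /chi_squared_test_fun; case: ifP.
apply: measurable_fun_ifT => //; apply: measurable_fun_ltr => //.
exact: measurable_chi_squared.
Qed.

Lemma chi_squared_test_fun_itv kappa tau z :
  0 <= chi_squared_test_fun kappa tau z <= 1.
Proof. by rewrite /chi_squared_test_fun ler0n lern1 leq_b1. Qed.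

Definition chi_squared_test (kappa : nat) (tau : R) : test :=
  Test (measurable_chi_squared_test_fun kappa tau)
       (chi_squared_test_fun_itv kappa tau).

End two_sample.
Arguments test R d m : clear implicits.
Arguments chi_squared_test {R} d m kappa tau.

(* Main.v *)
Require Import Defs.
From HB Require Import structures.
From mathcomp Require Import all_boot all_order all_algebra.
From mathcomp Require Import all_classical all_reals all_analysis.
From mathcomp Require Import measurable_realfun zify ring lra.

Set Implicit Arguments.
Unset Strict Implicit.
Unset Printing Implicit Defensive.

Import Order.TTheory GRing.Theory Num.Theory.
Import numFieldNormedType.Exports.

Local Open Scope classical_set_scope.
Local Open Scope ring_scope.

(** Write [p] and [q] for the vectors of bin probabilities of the two
    densities, [Delta] for the squared distance [sqdist p q] and [N] for the
    number of bins, [kappa ^ d].  Since the samples have the same size their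
    points can be paired: the pair number [i] contributes the vector [U_i] that
    is [1] at the bin of [X_i] and [-1] at the bin of [Y_i] (and [0] if these
    agree), and the statistic is the squared norm of the sum of the [U_i].  Its
    diagonal part is twice the number of pairs falling in two distinct bins, so
    at most [2 m], and its off-diagonal part is a U-statistic of mean
    [m (m - 1) Delta].  The densities are bounded by [L], so each bin has mass
    at most [L / N], and every variance needed is controlled by this bound.
    Under the null hypothesis the U-statistic is centred and degenerate with
    variance of order [m ^ 2 L / N], and Chebyshev's inequality at level
    [a m N ^ (-1/2)] gives a first error of order [L / a ^ 2]
    ([chi2_null_tail]).  Under the alternative Hoeffding's decomposition and
    Markov's inequality for the number of coincidences give a second error of
    the same order as soon as [m Delta] is at least [8 a ^ 2 N ^ (-1/2)]
    ([chi2_alternative_tail]).  Both computations are made on the finite space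
    of bin labels, where the law is an explicit product weight; the passage from
    the sampling model is [expectation_le_wexp].

    What remains is to bound [Delta] below when the [L2] distance of the
    densities is large ([integral_sqr_le]).  Averaging over bins is only a first
    order approximation, so for [s > 1] the difference [h] of the densities cannot
    be compared with its bin averages up to an error of order
    [kappa ^ (-s)]; instead, the averages are shown to dominate [h] up to a
    constant factor and such an error.  On a block of [r ^ d] bins let [M] be the
    supremum of [|h|].  A Landau-Kolmogorov inequality
    ([landau_kolmogorov]) applied along the segments of the block parallel to
    the axes shows that [h] oscillates over a bin by at most
    [C M / r + C' (r / kappa) ^ s].  Choosing [r] so that the first term is at
    most [M / 2] and looking at a point where [|h|] is close to [M] bounds [M]
    by twice the largest bin average of the block plus the Hoelder term
    ([block_bound]).  Squaring and summing over the bins costs a factor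
    depending only on [r] and [d].  With [kappa] of order
    [m ^ (2 / (4 s + d))] the Hoelder term is of the order of the separation
    [m ^ (- 2 s / (4 s + d))], hence absorbed by a large constant, and
    [m Delta] has the required size ([separated_bins]). *)

(** * Measure of boxes and full partitions *)

Section boxes.
Context {disp : measure_display} {T : measurableType disp} {R : realType}.

Definition box n (A : 'I_n -> set T) : set (n.-tuple T) :=
  [set t | forall i, A i (tnth t i)].

Lemma measurable_box n (A : 'I_n -> set T) :
  (forall i, measurable (A i)) -> measurable (box A).
Proof.
move=> mA; rewrite (_ : box A = \big[setI/setT]_(i < n) ((@tnth n T)^~ i @^-1` A i)).
  apply: bigsetI_measurable => i _; rewrite -[X in measurable X]setTI.
  exact: measurable_tnth.
rewrite -bigcap_seq; apply/seteqP; split=> t /= At i; first by move=> _; exact: At.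
exact: At (mem_index_enum i).
Qed.

Lemma tuple_measure_box (mu : {sigma_finite_measure set T -> \bar R}) n
    (A : 'I_n -> set T) : (forall i, measurable (A i)) ->
  tuple_measure mu n (box A) = (\prod_(i < n) mu (A i))%E.
Proof.
elim: n A => [|n IHn] A mA /=.
  rewrite big_ord0 diracE mem_set//= => i; by case: i.
rewrite /cons_measure /pushforward.
have -> : @cons_pair _ T n @^-1` box A = A ord0 `*` box (fun i => A (lift ord0 i)).
  apply/seteqP; split=> -[x t] /=; rewrite /cons_pair /=.
    by move=> At; split=> [|i]; [have := At ord0|have := At (lift ord0 i)];
      rewrite ?tnth0 ?tnthS.
  move=> [Ax At] i; case: (unliftP ord0 i) => [j ->|->].
    by rewrite tnthS; exact: At.
  by rewrite tnth0.
rewrite product_measure1E//; last exact: measurable_box.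
by rewrite IHn// big_ord_recl.
Qed.

End boxes.

(** The pieces need not exhaust [D]: equality of total mass makes what they
    leave out negligible. *)
Lemma ge0_integral_full_partition {disp : measure_display}
    {T : measurableType disp} {R : realType}
    (mu : {measure set T -> \bar R}) (J : finType) (B : J -> set T)
    (D : set T) (f : T -> \bar R) :
  measurable D -> (forall j, measurable (B j)) -> (forall j, B j `<=` D) ->
  (forall i j x, B i x -> B j x -> i = j) ->
  mu D = 1%E -> (\sum_j mu (B j) = 1)%E ->
  measurable_fun D f -> (forall x, D x -> (0 <= f x)%E) ->
  (\int[mu]_(x in D) f x = \sum_j \int[mu]_(x in B j) f x)%E.
Proof.
move=> mD mB BD dB muD muB mf f0.
pose E := \big[setU/set0]_(j <- index_enum J) B j.
have mE : measurable E by exact: bigsetU_measurable.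
have ED : E `<=` D by rewrite /E -bigcup_seq => x [j _ /BD].
have tB : trivIset [set` index_enum J] B.
  by move=> i j _ _ [x [Bi Bj]]; exact: dB Bi Bj.
have muE : mu E = 1%E.
  rewrite -(mul1e (mu E)) -integral_cst// -[RHS]muB /E ge0_integral_bigsetU//.
  - by apply: eq_bigr => j _; rewrite integral_cst// mul1e.
  - exact: index_enum_uniq.
have DE : D = E `|` (D `\` E) by rewrite setDE setUIr setUv setIT; apply/esym/setUidPr.
have mN : measurable (D `\` E) by exact: measurableD.
have dEN : [disjoint E & D `\` E] by apply/disj_setPS => x [] ? [].
have muN : mu (D `\` E) = 0%E.
  have : mu D = (mu E + mu (D `\` E))%E.
    by rewrite {1}DE measureU//; apply/eqP; move/disj_set2P: dEN => /eqP.
  rewrite muD muE; have := measure_ge0 mu (D `\` E).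
  case: (mu _) => [r| |]//= _ /eqP; rewrite -EFinD eqe -subr_eq0 => /eqP e.
  by congr EFin; lra.
rewrite {1}DE ge0_integral_setU//; last 2 first.
- by rewrite -DE.
- by rewrite -DE.
rewrite (null_set_integral mN _ muN) ?adde0; last first.
  by apply: measurable_funS mf => //; exact: subDsetl.
rewrite /E ge0_integral_bigsetU//.
- exact: index_enum_uniq.
- exact: measurable_funS mf.
- by move=> x /ED; exact: f0.
Qed.

(** * The bins and their masses *)

Section bins.
Context {R : realType} {d kappa : nat}.
Local Notation point := (d.-tuple (measurableTypeR R)).
Local Notation index := {ffun 'I_d -> 'I_kappa}.

Definition bin (k : index) : set point := [set x | in_bin k x].

Lemma binE k :
  bin k = box (T := measurableTypeR R)
    (fun l => `](k l)%:R / kappa%:R, (k l).+1%:R / kappa%:R]%classic).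
Proof.
apply/seteqP; split=> x /= => [/forallP|] kx.
  by move=> l; rewrite /= in_itv; exact: kx.
by apply/forallP => l; have := kx l; rewrite /= in_itv.
Qed.

Lemma measurable_bin k : measurable (bin k).
Proof. by rewrite binE; exact: measurable_box. Qed.

Lemma bin_itvP k x : bin k x <->
  forall l, (k l)%:R < kappa%:R * tnth x l <= (k l).+1%:R.
Proof.
have e l : ((k l)%:R / kappa%:R < tnth x l <= (k l).+1%:R / kappa%:R) =
    ((k l)%:R < kappa%:R * tnth x l <= (k l).+1%:R).
  have k0 : 0 < kappa%:R :> R by rewrite ltr0n; case: (kappa) (k l) => [[]|].
  by rewrite ltr_pdivrMr// ler_pdivlMr// ![_ * kappa%:R]mulrC.
split=> [/forallP kx l|kx]; first by rewrite -e.
by apply/forallP => l; rewrite e.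
Qed.

Lemma bin_cube k : bin k `<=` cube d.
Proof.
move=> x /forallP kx l; have /andP[lo hi] := kx l.
have k0 : 0 < kappa%:R :> R by rewrite ltr0n; case: (kappa) (k l) => [[]|].
apply/andP; split.
  by apply: le_trans (ltW lo); rewrite divr_ge0.
by apply: (le_trans hi); rewrite ler_pdivrMr// mul1r ler_nat.
Qed.

Lemma ceil_uniq (y : R) (i j : nat) :
  i%:R < y <= i.+1%:R -> j%:R < y <= j.+1%:R -> i = j.
Proof.
move=> /andP[i1 i2] /andP[j1 j2]; apply/eqP; rewrite eqn_leq.
by rewrite -[(i <= j)%N]ltnS -[(j <= i)%N]ltnS -!(ltr_nat R)
  (lt_le_trans i1)// (lt_le_trans j1).
Qed.

Lemma bin_disjoint k k' x : bin k x -> bin k' x -> k = k'.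
Proof.
move=> /bin_itvP kx /bin_itvP k'x; apply/ffunP => l; apply/val_inj => /=.
exact: ceil_uniq (kx l) (k'x l).
Qed.

Hypothesis kappa_gt0 : (0 < kappa)%N.
Let kappa0 : 0 < kappa%:R :> R. Proof. by rewrite ltr0n. Qed.

Lemma lebesgue_bin k : lebesgue_tuple d (bin k) = (kappa%:R ^- d)%:E.
Proof.
rewrite binE /lebesgue_tuple tuple_measure_box// (eq_bigr (fun=> (kappa%:R^-1)%:E)).
  by rewrite prodEFin prodr_const card_ord exprVn.
move=> l _ /=; rewrite lebesgue_measure_itv /= lte_fin ltr_pM2r ?invr_gt0//.
rewrite ltr_nat ltnSn -EFinD -mulrBl.
by congr EFin; rewrite -natr1 addrAC subrr add0r mul1r.
Qed.

Lemma lebesgue_cube : lebesgue_tuple d (cube d : set point) = 1%E.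
Proof.
rewrite (_ : cube d =
    box (T := measurableTypeR R) (fun=> `[0%R, 1%R]%classic)); last first.
  by apply/seteqP; split=> x /= h l; have := h l; rewrite /= in_itv.
rewrite /lebesgue_tuple tuple_measure_box// big1// => l _.
by rewrite /= lebesgue_measure_itv /= lte_fin ltr01 -EFinD subr0.
Qed.

Lemma card_bins : #|{: index}| = (kappa ^ d)%N.
Proof. by rewrite card_ffun !card_ord. Qed.

Lemma sum_bins_cst (c : R) : \sum_(k : index) c = kappa%:R ^+ d * c.
Proof. by rewrite sumr_const card_bins -[LHS]mulr_natl natrX. Qed.

Lemma ge0_integral_bins (f : point -> \bar R) :
  measurable_fun (cube d) f -> (forall x, cube d x -> (0 <= f x)%E) ->
  (\int[lebesgue_tuple d]_(x in cube d) f x =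
   \sum_k \int[lebesgue_tuple d]_(x in bin k) f x)%E.
Proof.
move=> mf f0; apply: ge0_integral_full_partition => //.
- exact: measurable_cube.
- exact: measurable_bin.
- exact: bin_cube.
- exact: bin_disjoint.
- exact: lebesgue_cube.
- rewrite (eq_bigr (fun=> (kappa%:R ^- d)%:E)); last by move=> k _; exact: lebesgue_bin.
  by rewrite sumEFin sum_bins_cst divff// expf_neq0// gt_eqF.
Qed.

Definition bin_mass (p : density R d) (k : index) : R := fine (law p (bin k)).

Lemma law_bin p k : law p (bin k) = (bin_mass p k)%:E.
Proof. by rewrite /bin_mass fineK// fin_num_measure//; exact: measurable_bin. Qed.

Lemma bin_massE p k :
  (bin_mass p k)%:E = (\int[lebesgue_tuple d]_(x in bin k) (p x)%:E)%E.
Proof. by rewrite -law_bin /law setIidl//; exact: bin_cube. Qed.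

Lemma bin_mass_ge0 p k : 0 <= bin_mass p k.
Proof. by rewrite /bin_mass fine_ge0//. Qed.

Lemma measurable_EFin_pdf (p : density R d) : measurable_fun (cube d) (EFin \o p).
Proof. by apply/measurable_EFinP; exact: measurable_pdf. Qed.

Lemma bin_mass_sum1 p : \sum_k bin_mass p k = 1.
Proof.
apply: EFin_inj; rewrite -sumEFin -(integral_pdf p) ge0_integral_bins.
- by apply: eq_bigr => k _; rewrite bin_massE.
- exact: measurable_EFin_pdf.
- by move=> x cx; rewrite lee_fin pdf_ge0.
Qed.

Lemma bin_mass_le (p : density R d) L k :
  (forall x, cube d x -> p x <= L) -> bin_mass p k <= L / kappa%:R ^+ d.
Proof.
move=> pL; rewrite -lee_fin bin_massE EFinM -(lebesgue_bin k).
rewrite -integral_cst; last exact: measurable_bin.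
apply: ge0_le_integral => //.
- exact: measurable_bin.
- by move=> x /bin_cube cx; rewrite lee_fin pdf_ge0.
- by apply: measurable_funS (measurable_EFin_pdf p);
     [exact: measurable_cube|exact: bin_cube].
- by move=> x /bin_cube cx; rewrite lee_fin pL.
Qed.

End bins.

(** * Moments under a product weight on a finite set *)

Section product_expectation.
Context {R : realFieldType} {Z : finType}.
Variables (w : Z -> R) (m : nat).
Hypothesis w_ge0 : forall t, 0 <= w t.
Hypothesis w_sum1 : \sum_t w t = 1.

Definition dmean (g : Z -> R) : R := \sum_t w t * g t.

Definition wexp (G : {ffun 'I_m -> Z} -> R) : R :=
  \sum_(z : {ffun 'I_m -> Z}) (\prod_i w (z i)) * G z.

Definition upd (z : {ffun 'I_m -> Z}) (i : 'I_m) (t : Z) : {ffun 'I_m -> Z} :=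
  [ffun j => if j == i then t else z j].

Lemma eq_wexp G1 G2 : G1 =1 G2 -> wexp G1 = wexp G2.
Proof. by move=> e; apply: eq_bigr => z _; rewrite e. Qed.

Lemma le_wexp G1 G2 : (forall z, G1 z <= G2 z) -> wexp G1 <= wexp G2.
Proof.
move=> h; apply: ler_sum => z _; apply: ler_wpM2l (h z).
by apply: prodr_ge0.
Qed.

Lemma wexpD G1 G2 : wexp (fun z => G1 z + G2 z) = wexp G1 + wexp G2.
Proof. by rewrite -big_split; apply: eq_bigr => z _; rewrite mulrDr. Qed.

Lemma wexpZ c G : wexp (fun z => c * G z) = c * wexp G.
Proof. by rewrite mulr_sumr; apply: eq_bigr => z _; rewrite mulrCA. Qed.

Lemma wexp_sum (J : finType) (P : pred J) (G : J -> {ffun 'I_m -> Z} -> R) :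
  wexp (fun z => \sum_(u | P u) G u z) = \sum_(u | P u) wexp (G u).
Proof.
rewrite /wexp exchange_big /=; apply: eq_bigr => z _.
by rewrite mulr_sumr.
Qed.

Lemma wexp_cst c : wexp (fun=> c) = c.
Proof.
rewrite /wexp -mulr_suml -(bigA_distr_bigA (fun _ t => w t)).
by rewrite big1 ?mul1r// => i _.
Qed.

(** Exchanging a coordinate with an independent copy of it is an involution
    that preserves the weights.  Averaging out a single coordinate in this way is
    what makes the cross terms below vanish. *)
Lemma wexp_resample (i : 'I_m) G :
  wexp G = wexp (fun z => dmean (fun t => G (upd z i t))).
Proof.
have -> : wexp G =
    \sum_(zt : {ffun 'I_m -> Z} * Z) \prod_j w (zt.1 j) * w zt.2 * G zt.1.
  rewrite -(pair_bigA _ (fun (z : {ffun 'I_m -> Z}) t => \prod_j w (z j) * w t * G z)) /=.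
  apply: eq_bigr => z _; rewrite -[LHS]mulr1 -w_sum1 mulr_sumr.
  by apply: eq_bigr => t _; rewrite mulrAC.
pose sw (zt : {ffun 'I_m -> Z} * Z) := (upd zt.1 i zt.2, zt.1 i).
have swK : involutive sw.
  move=> [z t]; rewrite /sw /= ffunE eqxx; congr pair; apply/ffunP => j.
  by rewrite !ffunE; case: eqVneq => // ->.
rewrite (reindex_inj (inv_inj swK)) /=.
transitivity (\sum_(zt : {ffun 'I_m -> Z} * Z)
    \prod_j w (zt.1 j) * (w zt.2 * G (upd zt.1 i zt.2))).
  apply: eq_bigr => -[z t] _ /=; rewrite !mulrA; congr (_ * _).
  rewrite (bigD1 i)//= ffunE eqxx [X in _ = X * _](bigD1 i)//=.
  under eq_bigr => j /negPf ji do rewrite ffunE ji.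
  by ring.
rewrite -(pair_bigA _ (fun (z : {ffun 'I_m -> Z}) t =>
  \prod_j w (z j) * (w t * G (upd z i t)))) /=.
by apply: eq_bigr => z _; rewrite mulr_sumr.
Qed.

Lemma wexp_coord i g : wexp (fun z => g (z i)) = dmean g.
Proof.
rewrite (wexp_resample i) -[RHS]wexp_cst; apply: eq_wexp => z.
by apply: eq_bigr => t _; rewrite ffunE eqxx.
Qed.

Lemma wexp_coord2 i j A : i != j ->
  wexp (fun z => A (z i) (z j)) = dmean (fun s => dmean (A s)).
Proof.
move=> ij; rewrite (wexp_resample j) -(wexp_coord i); apply: eq_wexp => z.
by apply: eq_bigr => t _; rewrite !ffunE eqxx (negPf ij).
Qed.

Lemma wexp_sqr_orthogonal (J : finType) (P : pred J)
    (X : J -> {ffun 'I_m -> Z} -> R) :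
  (forall u v, P u -> P v -> u != v -> wexp (fun z => X u z * X v z) = 0) ->
  wexp (fun z => (\sum_(u | P u) X u z) ^+ 2) =
  \sum_(u | P u) wexp (fun z => X u z ^+ 2).
Proof.
move=> orth; transitivity (wexp (fun z => \sum_(u | P u)
    \sum_(v | P v) X u z * X v z)).
  apply: eq_wexp => z; rewrite expr2 mulr_suml; apply: eq_bigr => u _.
  by rewrite mulr_sumr.
rewrite wexp_sum; apply: eq_bigr => u Pu; rewrite wexp_sum (bigD1 u)//=.
rewrite [X in _ + X]big1 ?addr0; last first.
  by move=> v /andP[Pv vu]; apply: orth => //; rewrite eq_sym.
by apply: eq_wexp => z; rewrite expr2.
Qed.

Lemma wexp_sqr_centred g : dmean g = 0 ->
  wexp (fun z => (\sum_i g (z i)) ^+ 2) = m%:R * dmean (fun t => g t ^+ 2).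
Proof.
move=> g0; rewrite (@wexp_sqr_orthogonal _ predT (fun i z => g (z i))).
  under eq_bigr do rewrite (wexp_coord _ (fun t => g t ^+ 2)).
  by rewrite sumr_const card_ord mulr_natl.
move=> i j _ _ ij; rewrite (wexp_resample i) -[RHS](wexp_cst 0).
apply: eq_wexp => z; rewrite -[RHS](mul0r (g (z j))) -g0 mulr_suml.
apply: eq_bigr => t _; rewrite !ffunE eqxx eq_sym (negPf ij); exact: mulrA.
Qed.

(** The terms [A (z i) (z j)], [i < j], of a degenerate U-statistic are
    uncorrelated: for two distinct pairs some index occurs in only one of
    them, and averaging over that coordinate first gives zero. *)
Lemma wexp_sqr_degenerate A :
  (forall s t, A s t = A t s) -> (forall t, dmean (A^~ t) = 0) ->
  wexp (fun z => (\sum_i \sum_(j | j != i) A (z i) (z j)) ^+ 2) <=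
  4 * m%:R ^+ 2 * dmean (fun s => dmean (fun t => A s t ^+ 2)).
Proof.
move=> symA A0; set EA2 := dmean _.
have EA2_ge0 : 0 <= EA2.
  by apply: sumr_ge0 => s _; rewrite mulr_ge0// sumr_ge0// => t _;
     rewrite mulr_ge0// sqr_ge0.
pose P (u : 'I_m * 'I_m) := (u.1 < u.2)%N.
pose X (u : 'I_m * 'I_m) (z : {ffun 'I_m -> Z}) := A (z u.1) (z u.2).
have half (z : {ffun 'I_m -> Z}) : \sum_i \sum_(j | j != i) A (z i) (z j) =
    2 * \sum_(u | P u) X u z.
  rewrite pair_big_dep /= (bigID P) /= mulrDl mul1r; congr (_ + _).
    apply: eq_bigl => -[i j] /=; rewrite /P /= andb_idl//.
    by apply: contraTneq => ->; rewrite ltnn.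
  have swK : involutive (fun u : 'I_m * 'I_m => (u.2, u.1)) by case.
  rewrite (reindex_inj (inv_inj swK)) /=.
  apply: eq_big => -[i j] /=; last by rewrite symA.
  by rewrite /P /= -leqNgt ltn_neqAle.
under eq_wexp do rewrite half exprMn.
rewrite wexpZ (_ : 2 ^+ 2 = 4 :> R); last by ring.
rewrite -mulrA ler_pM2l; last by lra.
rewrite wexp_sqr_orthogonal; last first.
  move=> u v Pu Pv uv.
  have key i (a b c : 'I_m) : b != i -> a != i -> c != i ->
      wexp (fun z => A (z i) (z a) * A (z b) (z c)) = 0.
    move=> bi ai ci; rewrite (wexp_resample i) -[RHS](wexp_cst 0).
    apply: eq_wexp => z; rewrite -[RHS](mul0r (A (z b) (z c))) -(A0 (z a)).
    rewrite mulr_suml; apply: eq_bigr => t _.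
    by rewrite !ffunE eqxx (negPf bi) (negPf ai) (negPf ci) mulrA.
  have u12 : u.1 != u.2 by rewrite neq_ltn [X in X || _]Pu.
  have [i1|i1] := boolP (u.1 \in [:: v.1; v.2]); last first.
    move: i1; rewrite !inE negb_or => /andP[n1 n2]; by apply: key; rewrite eq_sym.
  have [i2|i2] := boolP (u.2 \in [:: v.1; v.2]); last first.
    move: i2; rewrite !inE negb_or => /andP[n1 n2].
    under eq_wexp do rewrite /X symA.
    by apply: key => //; rewrite eq_sym.
  exfalso; clear u12; move: u v uv Pu Pv i1 i2 => [i j] [k l]; rewrite /P /= => uv ij kl.
  rewrite !inE => /orP[/eqP ?|/eqP ?] /orP[/eqP ?|/eqP ?]; subst.
  - by rewrite ltnn in ij.
  - by rewrite eqxx in uv.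
  - by rewrite ltnNge ltnW in ij.
  - by rewrite ltnn in ij.
apply: (@le_trans _ _ (\sum_(u | P u) EA2)).
  apply: ler_sum => u Pu; rewrite (wexp_coord2 (fun s t => A s t ^+ 2))//.
  by rewrite neq_ltn [X in X || _]Pu.
rewrite sumr_const -[X in X <= _]mulr_natl ler_wpM2r// expr2 -natrM ler_nat.
by rewrite (leq_trans (max_card _))// card_prod card_ord.
Qed.

End product_expectation.

(** * The chi-squared statistic of a sample of labels *)

Section chi_squared_moments.
Context {R : realFieldType} {I : finType}.
Variables (p q : I -> R) (beta : R) (m : nat).
Hypothesis p_ge0 : forall k, 0 <= p k.
Hypothesis q_ge0 : forall k, 0 <= q k.
Hypothesis p_sum1 : \sum_k p k = 1.
Hypothesis q_sum1 : \sum_k q k = 1.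
Hypothesis p_le : forall k, p k <= beta.
Hypothesis q_le : forall k, q k <= beta.

Definition pair_weight (z : I * I) : R := p z.1 * q z.2.
Local Notation w := pair_weight.

Definition label_diff (z : I * I) (k : I) : R := (z.1 == k)%:R - (z.2 == k)%:R.
Local Notation U := label_diff.

Definition label_dot (z z' : I * I) : R := \sum_k U z k * U z' k.
Local Notation H := label_dot.

Definition chi2 (z : {ffun 'I_m -> I * I}) : R := \sum_k (\sum_i U (z i) k) ^+ 2.

Definition sqdist : R := \sum_k (p k - q k) ^+ 2.

(* The inner product of [label_diff z] with [p - q], which is the mean of
   [label_dot z z'] over [z']. *)
Let lin (z : I * I) : R := (p z.1 - q z.1) - (p z.2 - q z.2).

Lemma pair_weight_ge0 z : 0 <= w z. Proof. exact: mulr_ge0. Qed.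

Lemma dmean_fst f : dmean w (fun z => f z.1) = \sum_k p k * f k.
Proof.
rewrite /dmean /w -(pair_bigA _ (fun k l => p k * q l * f k)) /=.
apply: eq_bigr => k _; rewrite -[RHS]mulr1 -q_sum1 mulr_sumr.
by apply: eq_bigr => l _; rewrite mulrAC.
Qed.

Lemma dmean_snd f : dmean w (fun z => f z.2) = \sum_k q k * f k.
Proof.
rewrite /dmean /w -(pair_bigA _ (fun k l => p k * q l * f l)) exchange_big /=.
apply: eq_bigr => l _; rewrite -[RHS]mul1r -p_sum1 mulr_suml.
by apply: eq_bigr => k _; rewrite mulrA.
Qed.

Lemma pair_weight_sum1 : \sum_z w z = 1.
Proof.
transitivity (dmean w (fun=> 1)); first by apply: eq_bigr => z _; rewrite mulr1.
rewrite (dmean_fst (fun=> 1)) -[RHS]p_sum1.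
by apply: eq_bigr => k _; rewrite mulr1.
Qed.

Let wsum1 := pair_weight_sum1.
Let w_ge0 := pair_weight_ge0.

Lemma dmeanD f g : dmean w (fun z => f z + g z) = dmean w f + dmean w g.
Proof. by rewrite -big_split; apply: eq_bigr => z _; rewrite mulrDr. Qed.

Lemma dmeanZ c f : dmean w (fun z => c * f z) = c * dmean w f.
Proof. by rewrite mulr_sumr; apply: eq_bigr => z _; rewrite mulrCA. Qed.

Lemma dmean_cst c : dmean w (fun=> c) = c.
Proof. by rewrite /dmean -mulr_suml wsum1 mul1r. Qed.

Lemma eq_dmean f g : f =1 g -> dmean w f = dmean w g.
Proof. by move=> e; apply: eq_bigr => z _; rewrite e. Qed.

Lemma le_dmean f g : (forall z, f z <= g z) -> dmean w f <= dmean w g.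
Proof. by move=> h; apply: ler_sum => z _; apply: ler_wpM2l (h z). Qed.

Lemma sum_delta (f : I -> R) a : \sum_k f k * (a == k)%:R = f a.
Proof.
rewrite (bigD1 a)//= eqxx mulr1 big1 ?addr0// => k.
by rewrite eq_sym => /negPf ->; rewrite mulr0.
Qed.

Lemma label_dotE z z' :
  H z z' = (z.1 == z'.1)%:R - (z.2 == z'.1)%:R
           - ((z.1 == z'.2)%:R - (z.2 == z'.2)%:R).
Proof.
rewrite /H; under eq_bigr do rewrite {2}/U mulrBr.
by rewrite sumrB !(sum_delta (U z)).
Qed.

Lemma label_dotC z z' : H z z' = H z' z.
Proof. by apply: eq_bigr => k _; rewrite mulrC. Qed.

Lemma label_dot_diag z : H z z = 2 - 2 * (z.1 == z.2)%:R.
Proof. by rewrite label_dotE !eqxx (eq_sym z.2) /=; ring. Qed.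

Lemma dmean_label_dot z' : dmean w (H^~ z') = lin z'.
Proof.
transitivity (dmean w (fun z => ((z.1 == z'.1)%:R - (z.1 == z'.2)%:R)
   + (-1) * ((z.2 == z'.1)%:R - (z.2 == z'.2)%:R))).
  apply: eq_dmean => z; rewrite /= label_dotE.
  by ring.
rewrite dmeanD dmeanZ (dmean_fst (fun k => (k == z'.1)%:R - (k == z'.2)%:R)).
rewrite (dmean_snd (fun k => (k == z'.1)%:R - (k == z'.2)%:R)).
have sd (f : I -> R) a b : \sum_k f k * ((k == a)%:R - (k == b)%:R) = f a - f b.
  rewrite -[in RHS](sum_delta f a) -[in RHS](sum_delta f b) -sumrB.
  by apply: eq_bigr => k _; rewrite mulrBr ![k == _]eq_sym.
by rewrite !sd /lin; ring.
Qed.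

Lemma dmean_lin : dmean w lin = sqdist.
Proof.
rewrite /lin (eq_dmean (g := fun z => (p z.1 - q z.1) + (-1) * (p z.2 - q z.2))).
  rewrite dmeanD dmeanZ (dmean_fst (fun k => p k - q k)).
  rewrite (dmean_snd (fun k => p k - q k)) mulN1r -sumrB.
  by apply: eq_bigr => k _; ring.
by move=> z; ring.
Qed.

Lemma sqdist_ge0 : 0 <= sqdist.
Proof. by apply: sumr_ge0 => k _; exact: sqr_ge0. Qed.

Lemma dmean_lin_sqr : dmean w (fun z => lin z ^+ 2) <= 4 * beta * sqdist.
Proof.
pose e k := 2 * (p k - q k) ^+ 2.
apply: (@le_trans _ _ (dmean w (fun z => e z.1 + e z.2))).
  apply: le_dmean => z; rewrite /lin /e.
  set a := p z.1 - _; set b := p z.2 - _; have := sqr_ge0 (a + b); nra.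
rewrite dmeanD dmean_fst dmean_snd -big_split /= mulr_sumr.
apply: ler_sum => k _; rewrite /e.
have := p_le k; have := q_le k; have := sqr_ge0 (p k - q k); nra.
Qed.

Lemma dmean_label_dot_sqr z : dmean w (fun z' => H z z' ^+ 2) <= 16 * beta.
Proof.
pose e k : R := 4 * ((z.1 == k)%:R + (z.2 == k)%:R).
apply: (@le_trans _ _ (dmean w (fun z' => e z'.1 + e z'.2))).
  apply: le_dmean => z'; rewrite label_dotE /e.
  by do 4!case: eqP => _ /=; nra.
rewrite dmeanD dmean_fst dmean_snd /e.
have sd (f : I -> R) : \sum_k f k * (4 * ((z.1 == k)%:R + (z.2 == k)%:R)) =
    4 * (f z.1 + f z.2).
  rewrite -(sum_delta f z.1) -(sum_delta f z.2) -big_split mulr_sumr.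
  by apply: eq_bigr => k _; rewrite mulrCA mulrDr.
rewrite !sd.
have := p_le z.1; have := p_le z.2; have := q_le z.1; have := q_le z.2; lra.
Qed.

Lemma prob_le1 (f : I -> R) :
  (forall k, 0 <= f k) -> \sum_k f k = 1 -> forall k, f k <= 1.
Proof.
move=> f0 f1 k; rewrite -f1 (bigD1 k)//= lerDl; exact: sumr_ge0.
Qed.

Lemma sqdist_le : sqdist <= 2 * beta /\ sqdist <= 2.
Proof.
have le c : (forall k, p k <= c) -> (forall k, q k <= c) -> sqdist <= 2 * c.
  move=> pc qc; apply: (@le_trans _ _ (\sum_k (c * p k + c * q k))).
    apply: ler_sum => k _; have := p_ge0 k; have := q_ge0 k.
    have := pc k; have := qc k; nra.
  by rewrite big_split /= -!mulr_sumr p_sum1 q_sum1; lra.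
split; first exact: le.
by rewrite -[leRHS]mulr1; apply: le; exact: prob_le1.
Qed.

(* The degenerate part in Hoeffding's decomposition of [label_dot]. *)
Let A z z' := H z z' - lin z - lin z' + sqdist.

(** The square of a sum of four terms is at most four times the sum of their
    squares, and each of these has a mean of order [beta]; for [sqdist ^ 2] this
    uses both bounds of [sqdist_le]. *)
Lemma dmean_centred_dot_sqr :
  dmean w (fun z => dmean w (fun z' => A z z' ^+ 2)) <= 144 * beta.
Proof.
have beta_ge0 : 0 <= beta.
  have [d1 _] := sqdist_le; have := sqdist_ge0; lra.
have [D1 D2] := sqdist_le; have D0 := sqdist_ge0.
apply: (@le_trans _ _ (dmean w (fun z => 4 * (16 * beta + 4 * beta * sqdist
   + 2 * sqdist) + 4 * lin z ^+ 2))).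
  apply: le_dmean => z.
  apply: (@le_trans _ _ (dmean w (fun z' => 4 * H z z' ^+ 2 +
      (4 * lin z' ^+ 2 + (4 * sqdist ^+ 2 + 4 * lin z ^+ 2))))).
    apply: le_dmean => z'; rewrite /A.
    move: (H z z') (lin z) (lin z') sqdist => a b c d.
    have := sqr_ge0 (a + b); have := sqr_ge0 (a + c); have := sqr_ge0 (a - d).
    have := sqr_ge0 (b - c); have := sqr_ge0 (b + d); have := sqr_ge0 (c + d).
    nra.
  rewrite !dmeanD !dmeanZ !dmean_cst.
  have := dmean_label_dot_sqr z; have := dmean_lin_sqr; nra.
rewrite dmeanD dmean_cst dmeanZ; have := dmean_lin_sqr; nra.
Qed.

Let offdiag (z : {ffun 'I_m -> I * I}) := \sum_i \sum_(j | j != i) H (z i) (z j).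

Lemma chi2_split z :
  chi2 z = 2 * m%:R - 2 * \sum_i ((z i).1 == (z i).2)%:R + offdiag z.
Proof.
transitivity (\sum_i \sum_j H (z i) (z j)).
  rewrite /chi2; under eq_bigr do rewrite expr2 mulr_suml.
  rewrite exchange_big; apply: eq_bigr => i _ /=.
  under eq_bigr do rewrite mulr_sumr.
  by rewrite exchange_big.
under eq_bigr => i _ do rewrite (bigD1 i)//= label_dot_diag.
by rewrite big_split sumrB /= sumr_const card_ord -mulr_sumr mulr_natr.
Qed.

(** Under the null hypothesis the off-diagonal part of the statistic is a
    degenerate U-statistic, and the diagonal part is at most [2 m]: Chebyshev
    on the former suffices. *)
Lemma chi2_null_tail t : p =1 q -> 0 < t ->
  wexp w (fun z => (2 * m%:R + t < chi2 z)%R%:R) <= 64 * m%:R ^+ 2 * beta / t ^+ 2.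
Proof.
move=> pq t0.
apply: (@le_trans _ _ (wexp w (fun z => t ^- 2 * offdiag z ^+ 2))).
  apply: le_wexp => // z; have [lt|_] := ltP; last first.
    by rewrite mulr_ge0 ?invr_ge0 ?sqr_ge0.
  rewrite mulrC ler_pdivlMr ?exprn_gt0// mul1r ler_sqr ?nnegrE ?ltW//.
    move: lt; rewrite chi2_split.
    have : 0 <= \sum_i ((z i).1 == (z i).2)%:R :> R by apply: sumr_ge0.
    by lra.
  move: lt; rewrite chi2_split.
  have : 0 <= \sum_i ((z i).1 == (z i).2)%:R :> R by apply: sumr_ge0.
  by move: t0; lra.
rewrite wexpZ mulrC ler_wpM2r ?invr_ge0 ?sqr_ge0//.
apply: (le_trans (wexp_sqr_degenerate _ _ _ _ _)) => //.
- exact: label_dotC.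
- by move=> z; rewrite dmean_label_dot /lin !pq; ring.
- rewrite -(dmean_cst (64 * _ * _)) -dmeanZ; apply: le_dmean => z.
  have := dmean_label_dot_sqr z; have : 0 <= m%:R ^+ 2 :> R by exact: sqr_ge0.
  nra.
Qed.

(** Off the null hypothesis the off-diagonal part has mean
    [m (m - 1) sqdist]; its fluctuation splits into a linear part of variance
    at most a multiple of [m ^ 3 beta sqdist] and a degenerate part of variance
    at most a multiple of [m ^ 2 beta].  The diagonal part falls short of [2 m]
    by twice the number of coincidences, which has mean at most [m beta]. *)
Lemma chi2_alternative_tail theta : (2 <= m)%N -> 0 < sqdist ->
  8 * theta <= m%:R ^+ 2 * sqdist ->
  wexp w (fun z => (chi2 z <= 2 * m%:R + theta)%R%:R) <=
    528 * beta / (m%:R * sqdist) + 18432 * beta / (m%:R * sqdist) ^+ 2.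
Proof.
move=> m2 D0 thetaD; set D := sqdist in D0 thetaD *; set M : R := m%:R.
have M2 : 2 <= M by rewrite ler_nat.
pose S (z : {ffun 'I_m -> I * I}) : R := \sum_i ((z i).1 == (z i).2)%:R.
pose G (z : {ffun 'I_m -> I * I}) : R := \sum_i (lin (z i) - D).
pose W (z : {ffun 'I_m -> I * I}) := \sum_i \sum_(j | j != i) A (z i) (z j).
have dec z : offdiag z = M * (M - 1) * D + 2 * (M - 1) * G z + W z.
  have row i c : \sum_(j < m | j != i) c = (M - 1) * c :> R.
    have : \sum_(j < m) c = M * c by rewrite sumr_const card_ord mulr_natl.
    by rewrite (bigD1 i)//= => e; rewrite mulrBl mul1r -e addrAC subrr add0r.
  have dbl f : \sum_i \sum_(j < m | j != i) f j = (M - 1) * \sum_i f i :> R.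
    rewrite (exchange_big_dep predT)//= mulr_sumr; apply: eq_bigr => j _.
    by under eq_bigl do rewrite eq_sym; rewrite row.
  rewrite /offdiag.
  transitivity (\sum_i ((\sum_(j | j != i) A (z i) (z j) +
      \sum_(j | j != i) (lin (z j) - D)) + \sum_(j < m | j != i) lin (z i))).
    apply: eq_bigr => i _; rewrite -!big_split; apply: eq_bigr => j _ /=.
    by rewrite /A -/D; ring.
  under eq_bigr => i _ do rewrite row.
  rewrite !big_split /= dbl -/(W z) -/(G z) -mulr_sumr.
  have -> : \sum_i lin (z i) = G z + M * D.
    rewrite /G [X in _ = X + _]sumrB [X in _ - X + _](_ : _ = M * D); first by ring.
    by rewrite sumr_const card_ord mulr_natl.
  by ring.
(* On the event, either twice the number of coincidences is at least
   [M ^ 2 * D / 8], or the off-diagonal part is below its mean by at least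
   [M ^ 2 * D / 4]; the coefficients are those of Markov's inequality in the two
   cases. *)
pose c1 := 128 / (M ^+ 2 * D ^+ 2).
pose c2 := 32 / (M ^+ 4 * D ^+ 2).
pose c3 := 16 / (M ^+ 2 * D).
have M0 : 0 < M by lra.
have MD0 : 0 < M ^+ 2 * D by rewrite mulr_gt0// exprn_gt0.
have bound z : (chi2 z <= 2 * M + theta)%R%:R <=
    c3 * S z + (c1 * G z ^+ 2 + c2 * W z ^+ 2).
  have S0 : 0 <= S z by apply: sumr_ge0.
  have Q0 : 0 <= c1 * G z ^+ 2 + c2 * W z ^+ 2.
    by rewrite addr_ge0// mulr_ge0 ?sqr_ge0// divr_ge0// ?mulr_ge0 ?exprn_ge0// ltW.
  have [le|_] := leP (chi2 z); last first.
    by rewrite addr_ge0// mulr_ge0// divr_ge0// ltW.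
  have [Sbig|Ssmall] := leP (M ^+ 2 * D) (16 * S z).
    rewrite -[leLHS]addr0 lerD// /c3 mulrAC ler_pdivlMr// mul1r//.
  rewrite -[leLHS]add0r lerD//; first by rewrite mulr_ge0// divr_ge0// ltW.
  have -> : c1 * G z ^+ 2 + c2 * W z ^+ 2 =
      (128 * M ^+ 2 * G z ^+ 2 + 32 * W z ^+ 2) / (M ^+ 2 * D) ^+ 2.
    by rewrite /c1 /c2; field; rewrite !gt_eqF.
  rewrite ler_pdivlMr ?exprn_gt0// mul1r.
  have Y : M ^+ 2 * D <= - 4 * (2 * (M - 1) * G z + W z).
    move: le; rewrite chi2_split dec -/(S z) -/M => le.
    have : 2 * (M * (M - 1) * D) >= M ^+ 2 * D by rewrite expr2; nra.
    lra.
  apply: (@le_trans _ _ ((- 4 * (2 * (M - 1) * G z + W z)) ^+ 2)).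
    by rewrite ler_sqr// nnegrE ?(ltW MD0)// (le_trans _ Y)// ltW.
  have : (M - 1) ^+ 2 * G z ^+ 2 <= M ^+ 2 * G z ^+ 2.
    by rewrite ler_wpM2r ?sqr_ge0// ler_sqr ?nnegrE; lra.
  have := sqr_ge0 (2 * (M - 1) * G z - W z); lra.
apply: (le_trans (le_wexp _ bound)) => //.
rewrite !wexpD !wexpZ.
have ES : wexp w S <= M * beta.
  rewrite /S wexp_sum (eq_bigr (fun=> dmean w (fun z => (z.1 == z.2)%:R))).
    rewrite sumr_const card_ord -[X in X <= _]mulr_natl ler_wpM2l ?(ltW M0)//.
    rewrite /dmean -(pair_bigA _ (fun k l => p k * q l * (k == l)%:R)) /=.
    rewrite -[leRHS]mul1r -[X in _ <= X * _]p_sum1 mulr_suml; apply: ler_sum => k _.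
    rewrite (_ : \sum_l _ = p k * q k) ?ler_wpM2l//.
    rewrite -[in RHS](sum_delta q k) mulr_sumr.
    by apply: eq_bigr => l _; rewrite mulrA.
  by move=> i _; rewrite (wexp_coord _ i (fun z => (z.1 == z.2)%:R)).
have EG : wexp w (fun z => G z ^+ 2) <= M * (4 * beta * D).
  rewrite (@wexp_sqr_centred _ _ w m wsum1 (fun t => lin t - D))//; last first.
    by rewrite dmeanD dmean_lin dmean_cst subrr.
  rewrite ler_wpM2l ?(ltW M0)//.
  have -> : dmean w (fun t => (lin t - D) ^+ 2) =
      dmean w (fun t => lin t ^+ 2) - D ^+ 2.
    rewrite (eq_dmean (g := fun t => lin t ^+ 2 + ((- 2 * D) * lin t + D ^+ 2))).
      by rewrite !dmeanD dmeanZ dmean_lin dmean_cst -/D; ring.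
    by move=> t; ring.
  by have := dmean_lin_sqr; have := sqr_ge0 D; rewrite -/D; lra.
have EW : wexp w (fun z => W z ^+ 2) <= 4 * M ^+ 2 * (144 * beta).
  apply: (le_trans (wexp_sqr_degenerate _ _ _ _ _)) => //.
  - by move=> z z'; rewrite /A label_dotC; ring.
  - move=> z'; rewrite (eq_dmean (g := fun z =>
      H z z' + ((- 1) * lin z + (D - lin z')))); last first.
      by move=> z; rewrite /A -/D; ring.
    rewrite dmeanD (dmeanD (fun z => - 1 * lin z)).
    rewrite dmean_label_dot dmeanZ dmean_lin dmean_cst -/D; ring.
  - have c0 : 0 <= 4 * M ^+ 2 by rewrite mulr_ge0 ?sqr_ge0.
    exact: ler_wpM2l c0 _ _ dmean_centred_dot_sqr.
have -> : 528 * beta / (M * D) + 18432 * beta / (M * D) ^+ 2 =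
    c3 * (M * beta) + (c1 * (M * (4 * beta * D)) + c2 * (4 * M ^+ 2 * (144 * beta))).
  by rewrite /c1 /c2 /c3; field; rewrite !gt_eqF.
have c_ge0 a b : 0 <= a -> 0 < b -> 0 <= a / b :> R by move=> ? /ltW ?; exact: divr_ge0.
by rewrite !lerD// ler_wpM2l// c_ge0// ?mulr_gt0// ?exprn_gt0.
Qed.

End chi_squared_moments.

(** * From the sampling model to labels *)

Section discretisation.
Context {R : realType} {d m kappa : nat}.
Local Notation point := (d.-tuple (measurableTypeR R)).
Local Notation sample := (m.-tuple point * m.-tuple point)%type.
Local Notation index := {ffun 'I_d -> 'I_kappa}.
Hypothesis kappa_gt0 : (0 < kappa)%N.
Variables p q : density R d.

Definition label_cell (z : {ffun 'I_m -> index * index}) : set sample :=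
  box (fun i => bin (z i).1) `*` box (fun i => bin (z i).2).

Lemma measurable_label_cell z : measurable (label_cell z).
Proof.
by apply: measurableX; apply: measurable_box => i; exact: measurable_bin.
Qed.

Lemma two_sample_law_cell z : two_sample_law m p q (label_cell z) =
  (\prod_i pair_weight (bin_mass p) (bin_mass q) (z i))%:E.
Proof.
have mb f : measurable (box (fun i => @bin R d kappa (f i)) : set (m.-tuple point)).
  by apply: measurable_box => i; exact: measurable_bin.
have iidE r f : iid (law r) m (box (fun i => @bin R d kappa (f i))) =
    (\prod_i bin_mass r (f i))%:E.
  rewrite /iid tuple_measure_box; last by move=> i; exact: measurable_bin.
  by rewrite -prodEFin; apply: eq_bigr => i _; exact: law_bin.
rewrite [LHS](product_measure1E (iid (law p) m) (iid (law q) m))//.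
by rewrite [LHS](congr2 mule (iidE p _) (iidE q _)) -EFinM -big_split.
Qed.

(** Up to a null set, the pairs of samples are classified by the bins of their
    points, and the classes have product weights. *)
Lemma expectation_le_wexp (phi : sample -> R) G :
  measurable_fun setT phi -> (forall x, 0 <= phi x) ->
  (forall z x, label_cell z x -> phi x <= G z) ->
  ('E_(two_sample_law m p q)[phi] <=
     (wexp (pair_weight (bin_mass p) (bin_mass q)) G)%:E)%E.
Proof.
move=> mphi phi0 phiG; rewrite unlock.
have mphiE : measurable_fun setT (EFin \o phi) by exact/measurable_EFinP.
rewrite (@ge0_integral_full_partition _ _ _ _ _ label_cell)//.
- rewrite /wexp -sumEFin; apply: lee_sum => z _.
  rewrite EFinM muleC -two_sample_law_cell -integral_cst; last first.
    exact: measurable_label_cell.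
  apply: ge0_le_integral => //.
  + exact: measurable_label_cell.
  + by move=> x _; rewrite lee_fin.
  + exact: measurable_funS mphiE.
  + by move=> x zx; rewrite lee_fin phiG.
- exact: measurable_label_cell.
- move=> z z' [X Y] [zX zY] [z'X z'Y]; apply/ffunP => i.
  have e1 := bin_disjoint (zX i) (z'X i); have e2 := bin_disjoint (zY i) (z'Y i).
  by move: (z i) (z' i) e1 e2 => [? ?] [? ?] /= -> ->.
- exact: probability_setT.
- rewrite (eq_bigr (fun z : {ffun 'I_m -> index * index} =>
    (\prod_i pair_weight (bin_mass p) (bin_mass q) (z i))%:E));
    last by move=> z _; exact: two_sample_law_cell.
  rewrite sumEFin -(bigA_distr_bigA (fun _ => _)) big1// => i _.
  by apply: pair_weight_sum1; exact: bin_mass_sum1.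
- by move=> x _; rewrite lee_fin.
Qed.

Lemma chi_squared_cell z x : label_cell z x -> chi_squared kappa x = chi2 z.
Proof.
move=> [zX zY]; apply: eq_bigr => k _; congr (_ ^+ 2).
have cnt (X : m.-tuple point) f : box (fun i => @bin R d kappa (f i)) X ->
    (bin_count k X)%:R = \sum_i (f i == k)%:R :> R.
  move=> fX; rewrite /bin_count -sum1_count natr_sum big_mkcond big_tuple.
  apply: eq_bigr => i _; have [<-|fk] := eqVneq; first by rewrite ifT//; exact: fX.
  by rewrite ifN//; apply: contra fk => /(bin_disjoint (fX i)) /eqP.
by rewrite (cnt _ _ zX) (cnt _ _ zY) -sumrB.
Qed.

End discretisation.

(** * A Landau-Kolmogorov inequality *)

Section landau.
Context {R : realType}.

(** The successive derivatives [phi k] are known through the conclusion of the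
    mean value theorem, which passes to subintervals; these are half-open like
    the bins. *)
Definition mean_value_chain (n : nat) (phi : nat -> R -> R) (a b : R) : Prop :=
  forall k, (k < n)%N -> forall t u, a < t -> t < u -> u <= b ->
  exists2 xi, t <= xi <= u & phi k u - phi k t = phi k.+1 xi * (u - t).

Fixpoint landau_cst (k : nat) : nat :=
  if k is k'.+1 then (2 * 3 ^ k * landau_cst k')%N else 1%N.

Variable n : nat.
Variables (phi : nat -> R -> R) (M K : R).

(** By induction there is such a point in the first and in the last third of the
    interval; the mean value theorem between them gives the next one. *)
Lemma exists_small_derivative k a b : (k <= n)%N -> a < b ->
  mean_value_chain n phi a b -> (forall t, a < t <= b -> `|phi 0%N t| <= M) ->
  exists2 xi, a < xi <= b & (b - a) ^+ k * `|phi k xi| <= (landau_cst k)%:R * M.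
Proof.
elim: k a b => [|k IHk] a b kn ab mv phiM.
  exists b; first by rewrite ab lexx.
  by rewrite expr0 !mul1r phiM// ab lexx.
pose l := (b - a) / 3; have l0 : 0 < l by rewrite /l; lra.
have bl : b = a + 3 * l by rewrite /l; lra.
have third a' : a <= a' -> a' + l <= b ->
    exists2 xi, a' < xi <= a' + l & l ^+ k * `|phi k xi| <= (landau_cst k)%:R * M.
  move=> aa' b'b; have := IHk a' (a' + l); rewrite addrAC subrr add0r; apply.
  - exact: ltnW.
  - by rewrite ltrDl.
  - move=> j jn t u a't tu ub'; apply: mv => //; first exact: le_lt_trans a't.
    exact: le_trans b'b.
  - by move=> t /andP[a't tb']; apply: phiM; rewrite (le_lt_trans aa')// (le_trans tb').
have [||x /andP[ax xl] phix] := third a; [by []|by lra|].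
have [||y /andP[ly yb] phiy] := third (a + 2 * l); [by lra|by lra|].
have xy : l <= y - x by lra.
have [|||xi /andP[x_xi xi_y] e] := mv k kn x y; [by []|by lra|by lra|].
exists xi; first by apply/andP; split; lra.
have -> : (b - a) ^+ k.+1 * `|phi k.+1 xi| =
    3 ^+ k.+1 * (l ^+ k * (l * `|phi k.+1 xi|)).
  by rewrite (mulrA (l ^+ k)) -exprSr mulrA -exprMn; congr (_ ^+ _ * _); rewrite bl; ring.
rewrite /= -/landau_cst natrM natrM natrX.
suff : l ^+ k * (l * `|phi k.+1 xi|) <= 2 * ((landau_cst k)%:R * M).
  have : 0 < 3 ^+ k.+1 :> R by rewrite exprn_gt0.
  by nra.
apply: (@le_trans _ _ (l ^+ k * (`|phi k y| + `|phi k x|))); last by lra.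
rewrite ler_wpM2l ?exprn_ge0 ?(ltW l0)//.
apply: le_trans (ler_normB _ _); rewrite e normrM mulrC ler_wpM2l//.
by apply: le_trans xy _; exact: ler_norm.
Qed.

Variables a b : R.
Hypothesis ab : a < b.
Hypothesis mv : mean_value_chain n phi a b.
Hypothesis phiM : forall t, a < t <= b -> `|phi 0%N t| <= M.
Hypothesis phiK :
  forall t u, a < t <= b -> a < u <= b -> `|phi n t - phi n u| <= K.

Let M_ge0 : 0 <= M.
Proof. by apply: le_trans (phiM (t := b) _); rewrite ?ab ?lexx. Qed.

Let len0 : 0 < b - a. Proof. by rewrite subr_gt0. Qed.

Lemma mean_value_chain_sym k t u : (k < n)%N -> a < t <= b -> a < u <= b ->
  exists2 xi, a < xi <= b & `|phi k t - phi k u| = `|phi k.+1 xi| * `|t - u|.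
Proof.
move=> kn /andP[at_ tb] /andP[au ub]; case: (ltgtP t u) => [tu|ut|->].
- have [xi /andP[txi xiu] e] := mv kn at_ tu ub; exists xi; first by lra.
  by rewrite distrC e normrM (distrC u).
- have [xi /andP[txi xiu] e] := mv kn au ut tb; exists xi; first by lra.
  by rewrite e normrM.
- by exists u; [lra|rewrite !subrr normr0 mulr0].
Qed.

Lemma derivative_bound k t : (k <= n)%N -> a < t <= b ->
  (b - a) ^+ k * `|phi k t| <=
  (\sum_(k <= j < n.+1) (landau_cst j)%:R) * M + (b - a) ^+ n * K.
Proof.
move=> kn; have [i e] : exists i, (i + k = n)%N by exists (n - k)%N; rewrite subnK.
elim: i k kn e t => [|i IHi] k kn e t tab.
  have [xi xiab phixi] := exists_small_derivative kn ab mv phiM.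
  move: e; rewrite add0n => ekn; subst k.
  rewrite big_nat1; apply: (@le_trans _ _ ((b - a) ^+ n * (`|phi n xi| + K))).
    rewrite ler_wpM2l ?exprn_ge0 ?(ltW len0)// -lerBlDl.
    by apply: le_trans (phiK tab xiab); apply: lerB_dist.
  by rewrite mulrDr lerD2r.
have kn' : (k < n)%N by rewrite -e addSn ltnS leq_addl.
have [xi xiab phixi] := exists_small_derivative kn ab mv phiM.
have [eta etaab eeta] := mean_value_chain_sym kn' tab xiab.
have IH := IHi k.+1 kn' (etrans (addnS _ _) e) eta etaab.
rewrite big_ltn// mulrDl -addrA.
apply: le_trans (lerD phixi IH).
rewrite exprSr -mulrA -mulrDr ler_wpM2l ?exprn_ge0 ?(ltW len0)//.
rewrite -lerBlDl (le_trans (lerB_dist _ _))// eeta mulrC ler_wpM2r//.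
by rewrite ler_norml; move: tab xiab => /andP[? ?] /andP[? ?]; apply/andP; split; lra.
Qed.

(** An inequality of Landau-Kolmogorov type.  Divided differences make each
    derivative small somewhere; the highest one is then small everywhere since
    it oscillates little, and integrating down bounds the first derivative. *)
Lemma landau_kolmogorov t u : a < t <= b -> a < u <= b ->
  `|phi 0%N t - phi 0%N u| <=
  `|t - u| / (b - a) * ((\sum_(j < n.+1) (landau_cst j)%:R) * M) + (b - a) ^+ n * K.
Proof.
move=> tab uab.
have K0 : 0 <= K by apply: le_trans (phiK tab tab); exact: normr_ge0.
have tu0 : 0 <= `|t - u| / (b - a) by rewrite divr_ge0// ltW.
have [n0|n_gt0] := posnP n.
  have := phiK tab uab; rewrite n0 expr0 mul1r => h.
  apply: (le_trans h); rewrite lerDr mulr_ge0//.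
  by rewrite mulr_ge0 ?sumr_ge0.
have [xi xiab ->] := mean_value_chain_sym n_gt0 tab uab.
have := derivative_bound n_gt0 xiab; rewrite expr1 => h.
apply: (@le_trans _ _ (`|t - u| / (b - a) * ((b - a) * `|phi 1%N xi|))).
  by rewrite mulrA mulfVK ?gt_eqF// mulrC.
have tu1 : `|t - u| / (b - a) <= 1.
  rewrite ler_pdivrMr// mul1r ler_norml.
  by move: tab uab => /andP[? ?] /andP[? ?]; apply/andP; split; lra.
apply: (le_trans (ler_wpM2l tu0 h)).
rewrite mulrDr lerD//; last first.
  by rewrite ler_piMl// mulr_ge0// exprn_ge0// ltW.
rewrite ler_wpM2l// ler_wpM2r// -(big_mkord predT (fun j => (landau_cst j)%:R)).
by rewrite [leRHS]big_ltn// lerDr.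
Qed.

End landau.

(** * Derivatives relative to a segment *)

Section relative_derivative.
Context {R : realType}.

(** One-sided at the end points, so that functions given on the cube only can be
    differentiated along its full edges. *)
Definition relative_derivative (a b : R) (f df : R -> R) : Prop :=
  forall t, a <= t <= b -> forall e : R, 0 < e -> exists2 r : R, 0 < r &
  forall u, a <= u <= b -> `|u - t| < r ->
    `|f u - f t - df t * (u - t)| <= e * `|u - t|.

Lemma relative_derivative_is_derive a b f df t :
  relative_derivative a b f df -> a < t < b -> is_derive t 1 f (df t).
Proof.
move=> fdf /andP[at_ tb].
have cv : h^-1 *: (f (h *: 1 + t) - f t) @[h --> 0^'] --> df t.
  apply/cvgrPdist_le => e e0.
  have [|r r0 rP] := fdf t _ e e0; first by rewrite !ltW.
  have m0 : 0 < Num.min r (Num.min (t - a) (b - t)).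
    by rewrite !lt_min r0 !subr_gt0 at_ tb.
  near=> h.
  have h0 : h != 0 by near: h; exact: nbhs_dnbhs_neq.
  have : `|h| < Num.min r (Num.min (t - a) (b - t)).
    by near: h; apply: dnbhs0_lt.
  rewrite !lt_min => /and3P[hr ha hb].
  have -> : h *: (1 : R) + t = h + t by rewrite /GRing.scale/= mulr1.
  have := rP (h + t); rewrite addrK => H.
  have hn := ler_norm h; have hn' := ler_norm (- h); rewrite normrN in hn'.
  have {}H := H ltac:(by lra) hr.
  rewrite distrC (_ : _ - _ = h^-1 * (f (h + t) - f t - df t * h)); last first.
    by rewrite /GRing.scale/=; field.
  by rewrite normrM normfV mulrC ler_pdivrMr ?normr_gt0.
apply: DeriveDef; first exact: cvgP cv.
exact: cvg_lim cv.
Unshelve. all: by end_near. Qed.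

Lemma relative_derivative_continuous a b f df :
  relative_derivative a b f df -> {within `[a, b], continuous f}.
Proof.
move=> fdf; apply/subspace_continuousP => t /=; rewrite in_itv /= => tab.
apply/cvgrPdist_le => e e0; rewrite near_withinE.
have [r r0 rP] := fdf t tab 1 ltr01.
pose D := `|df t| + 1; have D0 : 0 < D by rewrite ltr_wpDl.
near=> u; rewrite /= in_itv /= => uab.
have ur : `|u - t| < r by rewrite distrC; near: u; exact: cvgr_dist_lt.
have ue : `|u - t| <= e / D.
  by rewrite distrC; near: u; apply: cvgr_dist_le => //; rewrite divr_gt0.
rewrite distrC -[f u - f t](subrK (df t * (u - t))).
rewrite (le_trans (ler_normD _ _))// (le_trans (lerD (rP u uab ur) (lexx _)))//.
by rewrite normrM -mulrDl addrC mulrC -ler_pdivlMr.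
Unshelve. all: by end_near. Qed.

Lemma relative_derivative_MVT a b f df : a < b ->
  relative_derivative a b f df ->
  exists2 c, a <= c <= b & f b - f a = df c * (b - a).
Proof.
move=> ab fdf; have [||c cab e] := MVT_segment (f := f) (df := df) (ltW ab).
- move=> x; rewrite in_itv /= => xab.
  exact: (relative_derivative_is_derive fdf).
- exact: relative_derivative_continuous fdf.
- by exists c => //; move: cab; rewrite in_itv.
Qed.

Lemma relative_derivativeS a b a' b' f df : a <= a' -> b' <= b ->
  relative_derivative a b f df -> relative_derivative a' b' f df.
Proof.
move=> aa' b'b fdf t /andP[a't tb'] e e0.
have [|r r0 rP] := fdf t _ e e0; first by rewrite (le_trans aa') ?(le_trans tb').
exists r => // u /andP[a'u ub']; apply: rP.
by rewrite (le_trans aa') ?(le_trans ub').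
Qed.

Lemma relative_derivativeB a b f df g dg :
  relative_derivative a b f df -> relative_derivative a b g dg ->
  relative_derivative a b (fun t => f t - g t) (fun t => df t - dg t).
Proof.
move=> fdf gdg t tab e e0; have e20 : 0 < e / 2 by rewrite divr_gt0.
have [r r0 rP] := fdf t tab _ e20; have [r' r'0 r'P] := gdg t tab _ e20.
exists (Num.min r r'); first by rewrite lt_min r0.
move=> u uab; rewrite lt_min => /andP[ur ur'].
have := rP u uab ur; have := r'P u uab ur'.
set x := f u - _ - _; set y := g u - _ - _ => hy hx.
rewrite (_ : _ - _ - _ = x - y); last by rewrite /x /y; ring.
by apply: (le_trans (ler_normB _ _)); lra.
Qed.

End relative_derivative.

(** * Hoelder functions along coordinate lines *)

Section coordinate_lines.
Context {R : realType} {d : nat}.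
Local Notation point := (d.-tuple (measurableTypeR R)).

Definition line (x : point) (l : 'I_d) (t : R) : point :=
  [tuple if j == l then t else tnth x j | j < d].

Lemma line_cube x l t : cube d x -> 0 <= t <= 1 -> cube d (line x l t).
Proof. by move=> cx t01 i; rewrite tnth_mktuple; case: eqP. Qed.

Lemma enorm_delta (c : R) (l : 'I_d) : enorm (c *: delta_mx 0 l) = `|c|.
Proof.
rewrite /enorm (bigD1 l)//= big1 ?addr0 ?mxE ?eqxx ?mulr1 ?sqrtr_sqr//.
by move=> j /negPf jl; rewrite !mxE jl andbF mulr0 expr0n.
Qed.

Lemma vec_line x l t u :
  vec (line x l u) - vec (line x l t) = (u - t) *: delta_mx 0 l.
Proof.
apply/rowP => j; rewrite !mxE !tnth_mktuple eqxx /=.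
by case: eqP => _; rewrite ?mulr1 ?mulr0 ?subrr.
Qed.

Definition axes (l : 'I_d) (k : nat) : k.-tuple 'rV[R]_d :=
  [tuple of nseq k (delta_mx 0 l)].

Lemma enorm_axes l k i : enorm (tnth (axes l k) i) <= 1.
Proof.
by rewrite (tnth_nth 0) /= nth_nseq ltn_ord -(scale1r (delta_mx _ _)) enorm_delta normr1.
Qed.

Lemma opnorm_axes k (A : k.-tuple 'rV[R]_d -> R) c l :
  (opnorm A <= c%:E)%E -> `|A (axes l k)| <= c.
Proof.
move=> Ac; rewrite -lee_fin; apply: le_trans Ac.
by apply: ereal_sup_ubound => /=; exists (axes l k) => // i; exact: enorm_axes.
Qed.

Lemma multilinear_headZ k (A : k.+1.-tuple 'rV[R]_d -> R) c l :
  multilinear A ->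
  A [tuple of c *: delta_mx 0 l :: axes l k] = c * A (axes l k.+1).
Proof.
move=> mA; have subst h : [tuple if j == ord0 then h else tnth (axes l k.+1) j | j < k.+1]
    = [tuple of h :: axes l k].
  apply: eq_from_tnth => j; rewrite tnth_mktuple.
  case: (unliftP ord0 j) => [i ->|->]; last by rewrite eqxx tnth0.
  by rewrite [RHS]tnthS !(tnth_nth 0).
have A0 : A [tuple of 0 :: axes l k] = 0.
  have := mA ord0 (axes l k.+1) 1 0 0; rewrite /= !subst scaler0 addr0 mul1r.
  by move/eqP; rewrite -subr_eq0 opprD addrA subrr sub0r oppr_eq0 => /eqP.
have := mA ord0 (axes l k.+1) c (delta_mx 0 l) 0; rewrite /= !subst addr0 A0 addr0.
by move=> ->; congr (_ * A _); apply/val_inj.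
Qed.

Lemma holder_line (s L : R) (f : point -> R) x l : holder d s L f -> cube d x ->
  exists phi : nat -> R -> R,
  [/\ forall t, 0 <= t <= 1 -> phi 0%N t = f (line x l t),
      forall k, (k < strict_floor s)%N ->
        relative_derivative 0 1 (phi k) (phi k.+1) &
      forall t u, 0 <= t <= 1 -> 0 <= u <= 1 ->
        `|phi (strict_floor s) t - phi (strict_floor s) u| <=
        L * `|t - u| `^ (s - (strict_floor s)%:R)].
Proof.
set n := strict_floor s => -[F [[F0 Fml FD] FH _]] cx.
exists (fun k t => F k (line x l t) (axes l k)); split.
- move=> t t01; rewrite -F0; last exact: line_cube.
  by congr (F _ _ _); apply/val_inj.
- move=> k kn t t01 e e0.
  have [r r0 rP] := FD k _ kn (line_cube l cx t01) e e0.
  exists r => // u u01; have := rP _ (line_cube l cx u01).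
  rewrite /= vec_line enorm_delta => H /H /(opnorm_axes l).
  rewrite multilinear_headZ; last by apply: Fml => //; exact: line_cube.
  by rewrite mulrC.
- move=> t u t01 u01.
  have := FH _ _ (line_cube l cx t01) (line_cube l cx u01).
  by move=> /(opnorm_axes l); rewrite vec_line enorm_delta.
Qed.

Lemma holder_bound (s L : R) (f : point -> R) x : holder d s L f -> cube d x ->
  `|f x| <= L.
Proof.
move=> [F [[F0 _ _] _ FL]] cx; rewrite -F0//; have := FL 0%N x (leq0n _) cx.
move=> H; rewrite -lee_fin; apply: le_trans H.
by apply: ereal_sup_ubound => /=; exists [tuple] => // -[].
Qed.

Definition osc_cst (s : R) : R := \sum_(j < (strict_floor s).+1) (landau_cst j)%:R.

Lemma osc_cst_ge0 s : 0 <= osc_cst s. Proof. exact: sumr_ge0. Qed.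

Lemma holder_sub_line (s L : R) (f g : point -> R) x l a b M :
  0 < s -> 0 <= L -> holder d s L f -> holder d s L g -> cube d x ->
  0 <= a -> a < b -> b <= 1 ->
  (forall t, a < t <= b -> `|f (line x l t) - g (line x l t)| <= M) ->
  forall t u, a < t <= b -> a < u <= b ->
  `|(f (line x l t) - g (line x l t)) - (f (line x l u) - g (line x l u))| <=
  `|t - u| / (b - a) * (osc_cst s * M) + 2 * L * (b - a) `^ s.
Proof.
move=> s0 L0 Hf Hg cx a0 ab b1 hM t u tab uab; set n := strict_floor s.
have [phi [phi0 phiD phiH]] := holder_line l Hf cx.
have [psi [psi0 psiD psiH]] := holder_line l Hg cx.
have in01 v : a < v <= b -> 0 <= v <= 1.
  by move=> /andP[av vb]; rewrite (le_trans a0 (ltW av)) (le_trans vb).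
pose chi k v := phi k v - psi k v.
have chi0 v : a < v <= b -> chi 0%N v = f (line x l v) - g (line x l v).
  by move=> /in01 v01; rewrite /chi phi0// psi0.
rewrite -!chi0//.
have sn : 0 < s - n%:R by rewrite subr_gt0; case/andP: (strict_floorP s0).
have -> : 2 * L * (b - a) `^ s = (b - a) ^+ n * (2 * L * (b - a) `^ (s - n%:R)).
  rewrite mulrCA -powR_mulrn ?subr_ge0 ?(ltW ab)// -powRD ?subrKC//.
  by rewrite subr_eq0 gt_eqF ?implybT// subr_gt0.
apply: landau_kolmogorov => //.
- move=> k kn v w av vw wb.
  have [|c cvw e] := relative_derivative_MVT vw (df := chi k.+1) (f := chi k).
    apply: (@relative_derivativeS _ 0 1).
    + by rewrite (le_trans a0)// ltW.
    + exact: le_trans wb b1.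
    + by apply: relative_derivativeB; [exact: phiD|exact: psiD].
  by exists c.
- by move=> v vab; rewrite chi0// hM.
- move=> v w vab wab.
  have pw : `|v - w| `^ (s - n%:R) <= (b - a) `^ (s - n%:R).
    apply: ge0_ler_powR; rewrite ?nnegrE ?subr_ge0 ?(ltW ab)//.
      by rewrite -subr_ge0 ltW.
    by rewrite ler_norml; case/andP: vab; case/andP: wab => ????;
       apply/andP; split; lra.
  have := phiH _ _ (in01 _ vab) (in01 _ wab).
  have := psiH _ _ (in01 _ vab) (in01 _ wab); rewrite -/n.
  have := ler_wpM2l L0 pw.
  have := ler_normB (phi n v - phi n w) (psi n v - psi n w).
  rewrite (_ : phi n v - phi n w - (psi n v - psi n w) = chi n v - chi n w).
    by lra.
  by rewrite /chi; ring.
Qed.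

End coordinate_lines.

(** * Blocks of bins *)

Section block.
Context {R : realType} {d kappa r : nat}.
Local Notation point := (d.-tuple (measurableTypeR R)).
Local Notation index := {ffun 'I_d -> 'I_kappa}.
Hypothesis kappa_gt0 : (0 < kappa)%N.
Hypothesis r_gt0 : (0 < r)%N.
Variable start : 'I_d -> nat.
Hypothesis start_le : forall l, (start l + r <= kappa)%N.
Variables s L : R.
Hypothesis s_gt0 : 0 < s.
Hypothesis L_ge0 : 0 <= L.

Let kappa0 : 0 < kappa%:R :> R. Proof. by rewrite ltr0n. Qed.
Let r0 : 0 < r%:R :> R. Proof. by rewrite ltr0n. Qed.

Definition block : set point :=
  [set x | forall l, (start l)%:R < kappa%:R * tnth x l <= (start l + r)%:R].

Definition block_index (k : index) : bool :=
  [forall l, start l <= k l < start l + r]%N.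

Lemma block_cube : block `<=` cube d.
Proof.
move=> x xb l; have /andP[lo hi] := xb l; apply/andP; split.
  by rewrite -(pmulr_rge0 _ kappa0) ltW// (le_lt_trans _ lo).
rewrite -(ler_pM2l kappa0) mulr1 (le_trans hi)// ler_nat; exact: start_le.
Qed.

Lemma block_bin x : block x -> exists2 k, block_index k & bin k x.
Proof.
move=> xb; pose y l := kappa%:R * tnth x l.
have y0 l : 0 < y l by have /andP[+ _] := xb l; apply: le_lt_trans.
pose j l := strict_floor (y l).
have jP l : (j l)%:R < y l <= (j l).+1%:R := strict_floorP (y0 l).
have js l : (start l <= j l < start l + r)%N.
  have /andP[s1 s2] := xb l; have /andP[j1 j2] := jP l; apply/andP; split.
    by rewrite -ltnS -(ltr_nat R); exact: lt_le_trans s1 j2.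
  by rewrite -(ltr_nat R); exact: lt_le_trans j1 s2.
have jk l : (j l < kappa)%N by have /andP[_ h] := js l; exact: leq_trans h _.
exists [ffun l => Ordinal (jk l)].
  by apply/forallP => l; rewrite ffunE; exact: js.
by apply/bin_itvP => l; rewrite ffunE; exact: jP.
Qed.

Section oscillation.
Variables (f g : point -> R) (M : R).
Hypothesis f_holder : holder d s L f.
Hypothesis g_holder : holder d s L g.
Hypothesis M_bound : forall x, block x -> `|f x - g x| <= M.

(** The oscillation over a mesh step is estimated one coordinate at a time,
    each step being taken along a segment of full length in the block. *)
Lemma block_oscillation x y : block x -> block y ->
  (forall l, kappa%:R * `|tnth x l - tnth y l| <= 1) ->
  `|(f x - g x) - (f y - g y)| <=
    d%:R * (osc_cst s * M / r%:R + 2 * L * (r%:R / kappa%:R) `^ s).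
Proof.
move=> xb yb xy; set E := (X in _ <= _ * X).
(* [z i] has the first [i] coordinates of [y] and the others of [x]. *)
pose z i : point := [tuple if (j < i)%N then tnth y j else tnth x j | j < d].
have zb i : block (z i).
  by move=> l; rewrite tnth_mktuple; case: ifP => _; [exact: yb|exact: xb].
have M0 : 0 <= M by apply: le_trans (M_bound xb); exact: normr_ge0.
suff step i : (i <= d)%N -> `|(f x - g x) - (f (z i) - g (z i))| <= i%:R * E.
  have := step d (leqnn d); rewrite (_ : z d = y)//.
  by apply: eq_from_tnth => j; rewrite tnth_mktuple ltn_ord.
elim: i => [|i IHi] id.
  rewrite (_ : z 0%N = x) ?subrr ?normr0 ?mul0r//.
  by apply: eq_from_tnth => j; rewrite tnth_mktuple.
pose l := Ordinal id.
have zi : z i = line (z i) l (tnth x l).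
  apply: eq_from_tnth => j; rewrite !tnth_mktuple; case: eqP => // ->.
  by rewrite ltnn.
have zi1 : z i.+1 = line (z i) l (tnth y l).
  apply: eq_from_tnth => j; rewrite !tnth_mktuple ltnS leq_eqVlt -val_eqE /=.
  by case: eqP => // e; congr tnth; apply/val_inj.
pose a : R := (start l)%:R / kappa%:R; pose b : R := (start l + r)%:R / kappa%:R.
have abE t : (a < t <= b) = ((start l)%:R < kappa%:R * t <= (start l + r)%:R).
  by rewrite /a /b ltr_pdivrMr// ler_pdivlMr// ![_ * kappa%:R]mulrC.
have lenE : b - a = r%:R / kappa%:R by rewrite /b /a -mulrBl natrD addrAC subrr add0r.
have lineb t : a < t <= b -> block (line (z i) l t).
  move=> tab j; rewrite tnth_mktuple; case: eqP => [->|_]; last exact: zb.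
  by rewrite -abE.
have := @holder_sub_line R d s L f g (z i) l a b M s_gt0 L_ge0 f_holder g_holder.
move=> /(_ (block_cube (zb i))).
have a0 : 0 <= a by rewrite divr_ge0.
have ab : a < b by rewrite -subr_gt0 lenE divr_gt0.
have b1 : b <= 1 by rewrite ler_pdivrMr// mul1r ler_nat start_le.
move=> /(_ a0 ab b1 (fun t tab => M_bound (lineb t tab)) (tnth x l) (tnth y l)).
rewrite !abE => /(_ (xb l) (yb l)); rewrite -zi -zi1 lenE => H.
have {}H : `|f (z i) - g (z i) - (f (z i.+1) - g (z i.+1))| <= E.
  apply: (le_trans H); rewrite /E lerD2r.
  have -> : `|tnth x l - tnth y l| / (r%:R / kappa%:R) * (osc_cst s * M) =
      kappa%:R * `|tnth x l - tnth y l| * (osc_cst s * M / r%:R).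
    by field; rewrite !gt_eqF.
  by rewrite ler_piMl// divr_ge0 ?mulr_ge0 ?osc_cst_ge0.
rewrite -natr1 mulrDl mul1r.
apply: le_trans (lerD (IHi (ltnW id)) H).
by apply: le_trans (ler_normD _ _); rewrite addrA subrK.
Qed.

End oscillation.

(** The hypothesis is integrated over the bin in a form where both sides are
    nonnegative, [q + v <= p + c]. *)
Lemma bin_average_le (p q : density R d) (k : index) v c : 0 <= v -> 0 <= c ->
  (forall y, bin k y -> v <= p y - q y + c) ->
  v <= kappa%:R ^+ d * (bin_mass p k - bin_mass q k) + c.
Proof.
move=> v0 c0 H; have mb := @measurable_bin R d kappa k.
have massD (u : density R d) w : 0 <= w ->
    (\int[lebesgue_tuple d]_(x in bin k) ((u x)%:E + w%:E))%E =
    (bin_mass u k + w / kappa%:R ^+ d)%:E.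
  move=> w0; rewrite ge0_integralD//.
  - by rewrite EFinD bin_massE EFinM -(lebesgue_bin kappa_gt0 k) -integral_cst.
  - by move=> x /bin_cube cx; rewrite lee_fin pdf_ge0.
  - apply: measurable_funS (measurable_EFin_pdf u); first exact: measurable_cube.
    exact: bin_cube.
have : (bin_mass q k + v / kappa%:R ^+ d <= bin_mass p k + c / kappa%:R ^+ d).
  rewrite -lee_fin -!massD//; apply: ge0_le_integral => //.
  - by move=> x /bin_cube cx; rewrite -EFinD lee_fin addr_ge0// pdf_ge0.
  - apply: emeasurable_funD => //.
    apply: measurable_funS (measurable_EFin_pdf q); first exact: measurable_cube.
    exact: bin_cube.
  - apply: emeasurable_funD => //.
    apply: measurable_funS (measurable_EFin_pdf p); first exact: measurable_cube.
    exact: bin_cube.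
  - by move=> x kx; rewrite -!EFinD lee_fin; have := H x kx; lra.
have kd : 0 < kappa%:R ^+ d :> R by rewrite exprn_gt0.
rewrite -(ler_pM2l kd) !mulrDr ![_ ^+ d * (_ / _)]mulrCA !mulfV ?gt_eqF//.
lra.
Qed.

Lemma bin_average_abs_le (p q : density R d) (k : index) v c : 0 <= c ->
  (forall y, bin k y -> `|v - (p y - q y)| <= c) ->
  `|v| <= kappa%:R ^+ d * `|bin_mass p k - bin_mass q k| + c.
Proof.
move=> c0 H; have kd : 0 <= kappa%:R ^+ d :> R by rewrite exprn_ge0.
have [v0|v0] := leP 0 v.
  rewrite -(ger0_norm v0).
  have := @bin_average_le p q k `|v| c (normr_ge0 v) c0; rewrite normr_id => h.
  apply: le_trans (h _) _; last by rewrite lerD2r ler_wpM2l// ler_norm.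
  by move=> y /H; rewrite (ger0_norm v0) ler_norml => /andP[_]; lra.
rewrite distrC.
have := @bin_average_le q p k `|v| c (normr_ge0 v) c0 => h.
apply: le_trans (h _) _; last by rewrite lerD2r ler_wpM2l// ler_norm.
by move=> y /H; rewrite (ltr0_norm v0) ler_norml => /andP[+ _]; lra.
Qed.

(** Up to the Hoelder term the oscillation over a bin is at most [M / 2], where
    [M] is the supremum over the block, so the average over a bin where the
    difference comes close to [M] is at least about [M / 2]. *)
Lemma block_bound (p q : density R d) Q :
  holder d s L p -> holder d s L q -> 2 * d%:R * osc_cst s <= r%:R ->
  (forall k, block_index k ->
     kappa%:R ^+ d * `|bin_mass p k - bin_mass q k| <= Q) ->
  forall x, block x ->
  `|p x - q x| <= 2 * Q + 4 * d%:R * L * (r%:R / kappa%:R) `^ s.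
Proof.
move=> Hp Hq rbig HQ x xb.
pose S := [set `|p y - q y| | y in block]; pose M := sup S.
have S0 : S !=set0 by exists `|p x - q x|; exists x.
have ubS : has_ubound S.
  exists (L + L) => _ [y yb <-]; apply: le_trans (ler_normB _ _) _.
  by rewrite lerD//; apply: holder_bound; eauto using block_cube.
have M_bound y : block y -> `|p y - q y| <= M.
  by move=> yb; apply: ub_le_sup => //; exists y.
have M0 : 0 <= M by apply: le_trans (M_bound x xb); exact: normr_ge0.
set P := (r%:R / kappa%:R) `^ s.
have P0 : 0 <= P by exact: powR_ge0.
have half : d%:R * (osc_cst s * M / r%:R) <= M / 2.
  rewrite mulrA ler_pdivrMr// mulrAC ler_pdivlMr//.
  have := ler_wpM2r M0 rbig; lra.
have ME : M <= Q + (M / 2 + 2 * d%:R * L * P).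
  apply: ge_sup => // _ [y yb <-].
  have [k kb ky] := block_bin yb.
  have := @bin_average_abs_le p q k (p y - q y) (M / 2 + 2 * d%:R * L * P).
  move=> h; apply: le_trans (h _ _) _.
  - by rewrite addr_ge0 ?divr_ge0// !mulr_ge0.
  - move=> w kw; have wb : block w.
      move=> l; have /forallP /(_ l) /andP[lo hi] := kb.
      have /bin_itvP/(_ l)/andP[w1 w2] := kw; apply/andP; split.
        by apply: le_lt_trans w1; rewrite ler_nat.
      by apply: (le_trans w2); rewrite ler_nat.
    apply: le_trans (block_oscillation Hp Hq M_bound yb wb _) _.
      move=> l; rewrite -{1}(ger0_norm (ltW kappa0)) -normrM mulrBr.
      have /bin_itvP/(_ l)/andP[w1 w2] := kw.
      have /bin_itvP/(_ l)/andP[y1 y2] := ky.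
      by rewrite ler_norml; move: w2 y2; rewrite -natr1 => ??; apply/andP; split; lra.
    by rewrite -/P mulrDr; lra.
  - by rewrite lerD2r; exact: HQ.
apply: le_trans (M_bound x xb) _; lra.
Qed.

End block.

(** * Bin masses control the L2 distance *)

Section reconstruction.
Context {R : realType} {d kappa r : nat}.
Local Notation point := (d.-tuple (measurableTypeR R)).
Local Notation index := {ffun 'I_d -> 'I_kappa}.
Hypothesis kappa_gt0 : (0 < kappa)%N.

(** The block of [k] has [k] as its lowest bin, unless it would then leave the
    cube. *)
Definition block_start (k : index) (l : 'I_d) : nat := minn (k l) (kappa - r).

Section small_blocks.
Hypothesis r_gt0 : (0 < r)%N.
Hypothesis r_le : (r <= kappa)%N.

Lemma block_start_le k l : (block_start k l + r <= kappa)%N.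
Proof. by rewrite -[X in (_ <= X)%N](subnK r_le) leq_add2r geq_minr. Qed.

Lemma block_startP k l : (block_start k l <= k l < block_start k l + r)%N.
Proof.
rewrite geq_minl /= /block_start; case: (leqP (k l) (kappa - r)) => _.
  by rewrite -[X in (X < _)%N]addn0 ltn_add2l.
by rewrite subnK.
Qed.

Lemma bin_block k : bin k `<=` @block R d kappa r (block_start k).
Proof.
move=> x /bin_itvP kx l; have /andP[x1 x2] := kx l.
have /andP[lo hi] := block_startP k l; apply/andP; split.
  by apply: le_lt_trans x1; rewrite ler_nat.
by apply: (le_trans x2); rewrite ler_nat.
Qed.

(** A bin lies in its own block, so if that block contains [j] then the bin
    differs from [j] by less than [r] in every coordinate. *)
Lemma card_blocks_containing (j : index) :
  (#|[pred k | block_index (r := r) (block_start k) j]| <= (2 * r).+1 ^ d)%N.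
Proof.
(* The offset [r] keeps the difference of the two indices nonnegative. *)
pose shift (k : index) := [ffun l => inord (k l + r - j l) : 'I_(2 * r).+1].
rewrite -(card_in_image (f := shift)); last first.
  move=> k k'; rewrite !inE => /forallP kj /forallP k'j /ffunP e.
  apply/ffunP => l; apply/val_inj; have := congr1 val (e l); rewrite !ffunE /=.
  have /andP[? ?] := kj l; have /andP[? ?] := k'j l.
  have /andP[? ?] := block_startP k l; have /andP[? ?] := block_startP k' l.
  by rewrite !inordK; lia.
by rewrite (leq_trans (max_card _))// card_ffun !card_ord.
Qed.

End small_blocks.

Variables s L : R.
Hypothesis s_gt0 : 0 < s.
Hypothesis L_ge0 : 0 <= L.

Lemma integral_le_bins (f : point -> R) (c : index -> R) :
  measurable_fun (cube d) f -> (forall x, 0 <= f x) ->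
  (forall k x, bin k x -> f x <= c k) ->
  (\int[lebesgue_tuple d]_(x in cube d) (f x)%:E <=
     (kappa%:R ^- d * \sum_k c k)%:E)%E.
Proof.
move=> mf f0 fc; have mfE : measurable_fun (cube d) (EFin \o f).
  exact/measurable_EFinP.
rewrite (ge0_integral_bins kappa_gt0)//; last by move=> x _; rewrite lee_fin.
rewrite mulr_sumr -sumEFin; apply: lee_sum => k _.
have mk := @measurable_bin R d kappa k.
rewrite EFinM muleC -(lebesgue_bin kappa_gt0 k) -integral_cst//.
apply: ge0_le_integral => //.
- by move=> x _; rewrite lee_fin.
- by apply: measurable_funS mfE; [exact: measurable_cube|exact: bin_cube].
- by move=> x kx; rewrite lee_fin fc.
Qed.

(** On each bin the difference is estimated by [block_bound] in the block of that
    bin, and a bin belongs to boundedly many blocks.  When [kappa < r] no block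
    fits in the cube, but then the error term alone suffices. *)
Lemma integral_sqr_le (p q : density R d) :
  (0 < r)%N -> 2 * d%:R * osc_cst s <= r%:R -> holder d s L p -> holder d s L q ->
  (\int[lebesgue_tuple d]_(x in cube d) ((p x - q x) ^+ 2)%:E <=
     (8 * (2 * r).+1%:R ^+ d * kappa%:R ^+ d *
        sqdist (@bin_mass R d kappa p) (bin_mass q) +
      (32 * d%:R ^+ 2 + 4) * L ^+ 2 * (r%:R / kappa%:R) `^ s ^+ 2)%:E)%E.
Proof.
move=> r_gt0 rbig Hp Hq; set P := _ `^ s; set D := sqdist _ _.
have P0 : 0 <= P by exact: powR_ge0.
have kd : 0 < kappa%:R ^+ d :> R by rewrite exprn_gt0// ltr0n.
have D0 : 0 <= D by exact: sqdist_ge0.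
have mpq : measurable_fun (cube d) (fun x => (p x - q x) ^+ 2).
  by apply: measurable_funX; apply: measurable_funB; exact: measurable_pdf.
have [r_le|k_lt] := leqP r kappa; last first.
  apply: le_trans (integral_le_bins (c := fun=> 4 * L ^+ 2 * P ^+ 2) mpq _ _) _.
  - by move=> x; exact: sqr_ge0.
  - move=> k x /bin_cube cx; have := holder_bound Hp cx; have := holder_bound Hq cx.
    rewrite !ler_norml => /andP[? ?] /andP[? ?].
    have P1 : 1 <= P ^+ 2.
      rewrite exprn_ege1// -(powRr0 (r%:R / kappa%:R)) ler_powR ?ltW//.
      by rewrite ltr_pdivlMr ?ltr0n// mul1r ltr_nat.
    have : 0 <= L ^+ 2 by exact: sqr_ge0.
    nra.
  - rewrite sum_bins_cst mulKf ?gt_eqF// lee_fin.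
    have : 0 <= 8 * (2 * r).+1%:R ^+ d * kappa%:R ^+ d * D.
      by rewrite !mulr_ge0// ?exprn_ge0// ltW.
    have : 0 <= 32 * d%:R ^+ 2 * L ^+ 2 * P ^+ 2 by rewrite !mulr_ge0// sqr_ge0.
    lra.
pose blk (k j : index) := block_index (r := r) (block_start k) j.
pose e (j : index) := kappa%:R ^+ d * `|bin_mass p j - bin_mass q j|.
have e_sqr j : e j ^+ 2 = (kappa%:R ^+ d) ^+ 2 * (bin_mass p j - bin_mass q j) ^+ 2.
  by rewrite /e exprMn real_normK// num_real.
pose Q2 (k : index) : R := \sum_(j | blk k j) e j ^+ 2.
have Q20 k : 0 <= Q2 k by apply: sumr_ge0 => j _; exact: sqr_ge0.
apply: le_trans (integral_le_bins
  (c := fun k => 8 * Q2 k + 32 * d%:R ^+ 2 * L ^+ 2 * P ^+ 2) mpq _ _) _.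
- by move=> x; exact: sqr_ge0.
- move=> k x kx; rewrite -real_normK ?num_real//.
  have h : `|p x - q x| <= 2 * Num.sqrt (Q2 k) + 4 * d%:R * L * P.
    apply: (block_bound kappa_gt0 r_gt0 (start := block_start k) _ s_gt0 L_ge0) => //.
    - by move=> l; exact: block_start_le.
    - move=> j kj; rewrite -[leLHS]ger0_norm; last by rewrite mulr_ge0// ltW.
      rewrite -sqrtr_sqr ler_wsqrtr// /Q2 (bigD1 j)//= lerDl.
      by apply: sumr_ge0 => i _; exact: sqr_ge0.
    - exact: bin_block.
  apply: (@le_trans _ _ ((2 * Num.sqrt (Q2 k) + 4 * d%:R * L * P) ^+ 2)).
    by rewrite ler_sqr ?nnegrE// (le_trans _ h).
  have := sqr_sqrtr (Q20 k).
  have := sqr_ge0 (2 * Num.sqrt (Q2 k) - 4 * d%:R * L * P).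
  nra.
- rewrite lee_fin big_split /= sum_bins_cst mulrDr mulKf ?gt_eqF//.
  rewrite -mulr_sumr lerD//; last first.
    have : 0 <= L ^+ 2 * P ^+ 2 by rewrite mulr_ge0// sqr_ge0.
    lra.
  have -> : \sum_k Q2 k = \sum_j \sum_(k | blk k j) e j ^+ 2.
    by rewrite /Q2 (exchange_big_dep predT).
  have cnt j : \sum_(k | blk k j) e j ^+ 2 <= (2 * r).+1%:R ^+ d * e j ^+ 2.
    rewrite sumr_const -[leLHS]mulr_natl ler_wpM2r ?sqr_ge0// -natrX ler_nat.
    exact: card_blocks_containing.
  apply: (@le_trans _ _ (kappa%:R ^- d * (8 *
      \sum_j ((2 * r).+1%:R ^+ d * e j ^+ 2)))).
    rewrite ler_wpM2l ?invr_ge0 ?(ltW kd)// ler_wpM2l//; exact: ler_sum.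
  rewrite -mulr_sumr (eq_bigr _ (fun j _ => e_sqr j)) -mulr_sumr -/(sqdist _ _) -/D.
  rewrite le_eqVlt; apply/orP; left; apply/eqP.
  clear D0; move: kd; move: (kappa%:R ^+ d) (_.+1%:R ^+ d) D => K N D' K0.
  by field; rewrite gt_eqF.
Qed.

End reconstruction.

(** * The two errors of the test *)

Section error_bounds.
Context {R : realType} {d m kappa : nat}.
Variables (L a : R).
Hypothesis L_gt0 : 0 < L.
Hypothesis a_ge1 : 1 <= a.
Hypothesis m_gt0 : (0 < m)%N.
Hypothesis kappa_gt0 : (0 < kappa)%N.

Let v : R := kappa%:R `^ (- (d%:R / 2)).
Let tau : R := 2 * m%:R + a * m%:R * v.

Let M0 : 0 < m%:R :> R. Proof. by rewrite ltr0n. Qed.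
Let a0 : 0 < a. Proof. exact: lt_le_trans ltr01 a_ge1. Qed.

Lemma mesh_gt0 : 0 < v.
Proof. by rewrite powR_gt0// ltr0n. Qed.

Lemma mesh_le1 : v <= 1.
Proof.
rewrite /v powRN invf_le1 ?powR_gt0 ?ltr0n//.
by rewrite -[leLHS](powRr0 kappa%:R) ler_powR ?ler1n// divr_ge0.
Qed.

Lemma mesh_sqr : v ^+ 2 = kappa%:R ^- d.
Proof.
have k0 : kappa%:R != 0 :> R by rewrite pnatr_eq0 -lt0n.
rewrite expr2 -powRD ?k0 ?implybT// -opprD -splitr powRN powR_mulrn//.
Qed.

Let v0 := mesh_gt0.
Let v1 := mesh_le1.

Lemma type1_error (p : density R d) : (forall x, cube d x -> `|p x| <= L) ->
  ('E_(two_sample_law m p p)[chi_squared_test d m kappa tau] <=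
     (64 * L / a ^+ 2)%:E)%E.
Proof.
move=> pL; pose P := @bin_mass R d kappa p.
apply: le_trans (@expectation_le_wexp R d m kappa kappa_gt0 p p _
  (fun z => (tau < chi2 z)%R%:R) _ _ _) _.
- exact: measurable_test.
- by move=> x; case/andP: (test_itv (chi_squared_test d m kappa tau) x).
- by move=> z x zx; rewrite /= /chi_squared_test_fun (chi_squared_cell zx).
rewrite lee_fin.
apply: le_trans (chi2_null_tail (p := P) (q := P) (beta := L * v ^+ 2) m
  _ _ _ _ _ _ _ _) _.
- exact: bin_mass_ge0.
- exact: bin_mass_ge0.
- exact: bin_mass_sum1.
- exact: bin_mass_sum1.
- move=> k; rewrite mesh_sqr; apply: bin_mass_le => // x cx.
  by apply: le_trans (pL x cx); exact: ler_norm.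
- move=> k; rewrite mesh_sqr; apply: bin_mass_le => // x cx.
  by apply: le_trans (pL x cx); exact: ler_norm.
- by [].
- by rewrite !mulr_gt0.
rewrite le_eqVlt; apply/orP; left; apply/eqP.
by field; rewrite !gt_eqF.
Qed.

Lemma sqdist_one_bin (p q : density R d) : kappa = 1%N ->
  sqdist (@bin_mass R d kappa p) (bin_mass q) = 0.
Proof.
move=> k1; have mass1 (u : density R d) k : @bin_mass R d kappa u k = 1.
  rewrite -(bin_mass_sum1 kappa_gt0 u) (bigD1 k)//= big1 ?addr0// => j /eqP[].
  apply/ffunP => l; apply/val_inj => /=.
  by case: (j l) (k l) => [x xk] [y yk] /=; move: xk yk; rewrite k1; lia.
by rewrite /sqdist big1// => k _; rewrite !mass1 subrr expr0n.
Qed.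

Lemma type2_error (p q : density R d) :
  (forall x, cube d x -> `|p x| <= L) -> (forall x, cube d x -> `|q x| <= L) ->
  (m = 1 -> kappa = 1)%N ->
  8 * a ^+ 2 * v <= m%:R * sqdist (@bin_mass R d kappa p) (bin_mass q) ->
  ('E_(two_sample_law m p q)[(fun z =>
       1 - chi_squared_test d m kappa tau z)%R] <= (354 * L / a ^+ 2)%:E)%E.
Proof.
move=> pL qL mk; set D := sqdist _ _ => sep.
pose P := @bin_mass R d kappa p; pose Q := @bin_mass R d kappa q.
have MD0 : 0 < m%:R * D by apply: lt_le_trans sep; rewrite !mulr_gt0// exprn_gt0.
have D0 : 0 < D by rewrite -(pmulr_rgt0 _ M0).
apply: le_trans (@expectation_le_wexp R d m kappa kappa_gt0 p q _
  (fun z => (chi2 z <= tau)%R%:R) _ _ _) _.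
- by apply: measurable_funB => //; exact: measurable_test.
- move=> x; case/andP: (test_itv (chi_squared_test d m kappa tau) x) => _.
  by rewrite subr_ge0.
- move=> z x zx; rewrite /= /chi_squared_test_fun (chi_squared_cell zx).
  by rewrite [chi2 z <= tau]leNgt; case: (_ < chi2 z); rewrite ?subrr ?subr0.
rewrite lee_fin.
apply: le_trans (chi2_alternative_tail (p := P) (q := Q) (beta := L * v ^+ 2)
  (theta := a * m%:R * v) _ _ _ _ _ _ _ _ _) _.
- exact: bin_mass_ge0.
- exact: bin_mass_ge0.
- exact: bin_mass_sum1.
- exact: bin_mass_sum1.
- move=> k; rewrite mesh_sqr; apply: bin_mass_le => // x cx.
  by apply: le_trans (pL x cx); exact: ler_norm.
- move=> k; rewrite mesh_sqr; apply: bin_mass_le => // x cx.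
  by apply: le_trans (qL x cx); exact: ler_norm.
- (* With a single bin the two mass vectors are equal. *)
  move: m_gt0; rewrite leq_eqVlt => /orP[/eqP/esym/mk k1|//].
  by move: D0; rewrite /D sqdist_one_bin// ltxx.
- exact: D0.
- have aa : a <= a ^+ 2 by rewrite expr2; have := a_ge1; nra.
  apply: (@le_trans _ _ (m%:R * (8 * a ^+ 2 * v))).
    have mv : 0 < m%:R * v by rewrite mulr_gt0.
    have := ler_wpM2r (ltW mv) aa; lra.
  by rewrite (expr2 m%:R) -[leRHS]mulrA ler_pM2l//; exact: sep.
rewrite -/D.
have s0 : 0 < 8 * a ^+ 2 * v by rewrite !mulr_gt0// exprn_gt0.
apply: (@le_trans _ _ (528 * (L * v ^+ 2) / (8 * a ^+ 2 * v) +
   18432 * (L * v ^+ 2) / (8 * a ^+ 2 * v) ^+ 2)).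
  have Lv : 0 <= L * v ^+ 2 by rewrite mulr_ge0 ?sqr_ge0// ltW.
  have anti (c x y : R) : 0 <= c -> 0 < x -> x <= y -> c / y <= c / x.
    by move=> c0 x0 xy; rewrite ler_wpM2l// lef_pV2 ?posrE// (lt_le_trans x0).
  have sep2 : (8 * a ^+ 2 * v) ^+ 2 <= (m%:R * D) ^+ 2.
    by rewrite ler_sqr ?nnegrE ?(ltW s0) ?(ltW MD0).
  have gen (c c' : R) : 0 <= c -> 0 <= c' ->
      c / (m%:R * D) + c' / (m%:R * D) ^+ 2 <=
      c / (8 * a ^+ 2 * v) + c' / (8 * a ^+ 2 * v) ^+ 2.
    by move=> c0 c'0; rewrite lerD ?anti ?exprn_gt0.
  apply: gen; exact: (mulr_ge0 (ler0n _ _) Lv).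
have -> : 528 * (L * v ^+ 2) / (8 * a ^+ 2 * v) +
   18432 * (L * v ^+ 2) / (8 * a ^+ 2 * v) ^+ 2 =
   (66 * L * v + 288 * L / a ^+ 2) / a ^+ 2.
  by field; rewrite !gt_eqF.
rewrite ler_pM2r ?invr_gt0 ?exprn_gt0//.
have : 288 * L / a ^+ 2 <= 288 * L.
  by rewrite ler_pdivrMr ?exprn_gt0// ler_peMr ?mulr_ge0 ?(ltW L_gt0)// exprn_ege1.
have := ler_wpM2l (ltW L_gt0) v1; lra.
Qed.

End error_bounds.

(** * Separation of the bin masses *)

Section separation.
Context {R : realType} {d : nat}.

Definition block_size (s : R) : nat := (Num.truncn (2 * d%:R * osc_cst s)).+1.

Lemma block_sizeP (s : R) : 2 * d%:R * osc_cst s <= (block_size s)%:R.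
Proof. by rewrite ltW// truncnS_gt. Qed.

Definition holder_error (L : R) : R := (32 * d%:R ^+ 2 + 4) * L ^+ 2.

(** The second term makes the Hoelder error at most half of the squared
    separation; the third one then yields the factor needed for the power of the
    test. *)
Definition separation_cst (s L : R) : R :=
  1 + 2 * holder_error L * ((2 * (block_size s)%:R) `^ s) ^+ 2
  + 128 * (2 * block_size s).+1%:R ^+ d.

Lemma holder_error_ge0 L : 0 <= holder_error L.
Proof. by rewrite mulr_ge0 ?sqr_ge0// addr_ge0// mulr_ge0// sqr_ge0. Qed.

Lemma separation_cst_ge1 s L : 1 <= separation_cst s L.
Proof.
rewrite /separation_cst -addrA lerDl addr_ge0//.
by rewrite mulr_ge0 ?sqr_ge0// mulr_ge0// holder_error_ge0.
Qed.

Lemma le_l2dist (p q : density R d) (eps J : R) : 0 <= eps ->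
  (eps%:E <= l2dist p q)%E ->
  (\int[lebesgue_tuple d]_(x in cube d) ((p x - q x) ^+ 2)%:E <= J%:E)%E ->
  eps ^+ 2 <= J.
Proof.
move=> eps0; rewrite /l2dist => epsI IJ.
have I0 : (0 <= \int[lebesgue_tuple d]_(x in cube d) ((p x - q x) ^+ 2)%:E)%E.
  by apply: integral_ge0 => x _; rewrite lee_fin sqr_ge0.
move: epsI I0 IJ; case: (\int[_]_(_ in _) _)%E => [I| |]//=.
rewrite !lee_fin => h I0; apply: le_trans; move: h.
rewrite powR12_sqrt// => h.
by rewrite -(sqr_sqrtr I0) ler_sqr ?nnegrE ?sqrtr_ge0.
Qed.

Variables (m : nat) (s L a eps : R).
Hypothesis m_gt0 : (0 < m)%N.
Hypothesis s_gt0 : 0 < s.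
Hypothesis L_gt0 : 0 < L.
Hypothesis a_ge1 : 1 <= a.

Let x : R := m%:R `^ (2 / (4 * s + d%:R)).
Let kappa : nat := Num.truncn x.
Hypothesis eps_ge :
  separation_cst s L * a * m%:R `^ (- (2 * s / (4 * s + d%:R))) <= eps.

Let q0 : 0 < 4 * s + d%:R.
Proof. by rewrite ltr_wpDr// mulr_gt0. Qed.

Lemma mesh_base_ge1 : 1 <= x.
Proof.
by rewrite /x -[leLHS](powRr0 m%:R) ler_powR ?ler1n// divr_ge0// ltW.
Qed.

Let x1 := mesh_base_ge1.
Let x0 : 0 < x. Proof. exact: lt_le_trans ltr01 x1. Qed.

Lemma truncn_mesh_gt0 : (0 < kappa)%N.
Proof. by rewrite /kappa truncn_gt0. Qed.

Lemma kappa_bounds : kappa%:R <= x /\ x / 2 <= kappa%:R.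
Proof.
have /andP[k1 k2] : kappa%:R <= x < kappa.+1%:R by apply: truncn_itv; exact: ltW.
have : 1 <= kappa%:R :> R by rewrite ler1n truncn_mesh_gt0.
by move: k2; rewrite -natr1; split=> //; lra.
Qed.

(** With [y = x `^ s] and [w = x `^ (d / 2)] the sample size is [y ^+ 2 * w],
    the separation is of order [y^-1], and [w] is at least the square root of
    the number of bins. *)
Lemma separated_bins (p q : density R d) :
  holder d s L p -> holder d s L q -> (eps%:E <= l2dist p q)%E ->
  8 * a ^+ 2 * kappa%:R `^ (- (d%:R / 2)) <=
    m%:R * sqdist (@bin_mass R d kappa p) (bin_mass q).
Proof.
move=> Hp Hq epspq; set D := sqdist _ _; set v := _ `^ (- _).
have [kx xk] := kappa_bounds.
have k0 : 0 < kappa%:R :> R by rewrite ltr0n truncn_mesh_gt0.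
pose y := x `^ s; pose w := x `^ (d%:R / 2).
have y0 : 0 < y by exact: powR_gt0.
have w0 : 0 < w by exact: powR_gt0.
have v0 : 0 < v by exact: powR_gt0.
have mE : m%:R = y ^+ 2 * w.
  have sd0 : 0 < s * 2 + d%:R / 2.
    by rewrite ltr_wpDr ?divr_ge0// mulr_gt0.
  rewrite -powR_mulrn ?ltW// /y /w -powRrM -powRD ?gt_eqF ?implybT//.
  rewrite /x -powRrM (_ : _ * _ = 1) ?powRr1//.
  by field; rewrite gt_eqF.
have epsE : m%:R `^ (- (2 * s / (4 * s + d%:R))) = y^-1.
  by rewrite /y -powRN /x -powRrM; congr (_ `^ _); field; rewrite gt_eqF.
have vw : 1 <= v * w.
  rewrite mulrC /v powRN -(ler_pM2r (powR_gt0 (d%:R / 2) k0)) mul1r.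
  rewrite mulfVK ?gt_eqF ?powR_gt0//.
  by apply: ge0_ler_powR; rewrite ?nnegrE ?divr_ge0// ltW.
have vE : v ^+ 2 = kappa%:R ^- d := mesh_sqr truncn_mesh_gt0.
pose r := block_size s; pose C0 := holder_error L.
pose rs := (2 * r%:R) `^ s; pose N : R := (2 * r).+1%:R ^+ d.
pose c2 := separation_cst s L.
have c2E : c2 = 1 + 2 * C0 * rs ^+ 2 + 128 * N by [].
have c21 : 1 <= c2 := separation_cst_ge1 s L.
have C00 : 0 <= C0 := holder_error_ge0 L.
have N0 : 0 < N by rewrite exprn_gt0.
have P_le : (r%:R / kappa%:R) `^ s <= rs / y.
  rewrite ler_pdivlMr// /y -powRM ?divr_ge0 ?(ltW x0)//.
  apply: ge0_ler_powR; rewrite ?nnegrE ?mulr_ge0 ?divr_ge0 ?(ltW x0) ?(ltW s_gt0)//.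
  rewrite mulrAC ler_pdivrMr// [2 * _]mulrC -mulrA ler_wpM2l//; lra.
have P2 : (r%:R / kappa%:R) `^ s ^+ 2 <= rs ^+ 2 / y ^+ 2.
  by rewrite -expr_div_n ler_sqr ?nnegrE ?powR_ge0 ?divr_ge0 ?powR_ge0.
have epsP : c2 * a / y <= eps by rewrite -epsE.
have ca0 : 0 <= c2 * a / y.
  by rewrite divr_ge0 ?powR_ge0// mulr_ge0 ?(le_trans ler01).
have := le_l2dist (le_trans ca0 epsP) epspq (integral_sqr_le truncn_mesh_gt0 s_gt0
  (ltW L_gt0) (r := r) (ltn0Sn _) (block_sizeP s) Hp Hq).
rewrite -/D -/N -/(holder_error L) -/C0 => J.
have main : (c2 * a / y) ^+ 2 <= 8 * N * kappa%:R ^+ d * D + C0 * (rs ^+ 2 / y ^+ 2).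
  apply: (@le_trans _ _ (eps ^+ 2)).
    by rewrite ler_sqr ?nnegrE// (le_trans ca0).
  by apply: (le_trans J); rewrite lerD2l ler_wpM2l.
have kd : kappa%:R ^+ d = v ^- 2 by rewrite vE invrK.
have {}main : c2 ^+ 2 * a ^+ 2 <= 8 * N * (v ^- 2 * y ^+ 2 * D) + C0 * rs ^+ 2.
  have y20 : 0 < y ^+ 2 by rewrite exprn_gt0.
  move: main; rewrite -(ler_pM2r y20) kd.
  set lhs := (X in X <= _ -> _); set rhs := (X in _ <= X -> _).
  have -> : lhs = c2 ^+ 2 * a ^+ 2 by rewrite /lhs; field; rewrite gt_eqF.
  suff -> : rhs = 8 * N * (v ^- 2 * y ^+ 2 * D) + C0 * rs ^+ 2 by [].
  by rewrite /rhs; field; rewrite !gt_eqF.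
have a21 : 1 <= a ^+ 2 by rewrite exprn_ege1.
have sep : 16 * a ^+ 2 <= v ^- 2 * y ^+ 2 * D.
  have Crs : 0 <= C0 * rs ^+ 2 by rewrite mulr_ge0// sqr_ge0.
  rewrite -(ler_pM2l (_ : 0 < 8 * N)) ?mulr_gt0//.
  have c2a : c2 * a ^+ 2 <= c2 ^+ 2 * a ^+ 2.
    by rewrite ler_wpM2r ?sqr_ge0// expr2 ler_peMl// (le_trans ler01).
  have Ca : 2 * (C0 * rs ^+ 2) <= 2 * (C0 * rs ^+ 2) * a ^+ 2.
    by rewrite ler_peMr// mulr_ge0.
  have c2aE : c2 * a ^+ 2 = a ^+ 2 + 2 * (C0 * rs ^+ 2) * a ^+ 2 + 128 * N * a ^+ 2.
    by rewrite c2E; ring.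
  move: main c2a; rewrite c2aE; move: (c2 ^+ 2 * _) => c; lra.
have vsep : 16 * a ^+ 2 * v ^+ 2 <= y ^+ 2 * D.
  have v20 : 0 < v ^+ 2 by rewrite exprn_gt0.
  move: sep; rewrite -(ler_pM2r v20).
  by rewrite (_ : v ^- 2 * y ^+ 2 * D * v ^+ 2 = y ^+ 2 * D)//; field; rewrite gt_eqF.
rewrite mE [leRHS]mulrAC.
apply: le_trans (ler_wpM2r (ltW w0) vsep).
have av : 0 <= 8 * a ^+ 2 * v by rewrite mulr_ge0 ?(ltW v0)// mulr_ge0// sqr_ge0.
have := ler_wpM2l av vw; lra.
Qed.

End separation.

Theorem theorem4 (R : realType) (d : nat) (hd : (1 <= d)%N)
    (L : R) (hL : 0 < L) :
  exists2 c1 : R, 0 < c1 &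
  forall s : R, 0 < s ->
  exists2 c2 : R, 0 < c2 &
  forall (m : nat) (a : R), (1 <= m)%N -> 1 <= a ->
    let kappa : nat := Num.truncn (m%:R `^ (2 / (4 * s + d%:R))) in
    let tau : R := 2 * m%:R + a * m%:R * kappa%:R `^ (- (d%:R / 2)) in
    forall eps : R,
      c2 * a * m%:R `^ (- (2 * s / (4 * s + d%:R))) <= eps ->
      (risk (holder d s L) eps (chi_squared_test d m kappa tau)
         <= (c1 / a ^+ 2)%:E)%E.
Proof.
exists (418 * L); first exact: (mulr_gt0 (ltr0Sn _ _) hL).
move=> s s0; exists (separation_cst (d := d) s L).
  by rewrite (lt_le_trans ltr01)// separation_cst_ge1.
move=> m a m0 a1 /= eps eps_ge.
have k0 := truncn_mesh_gt0 (d := d) m0 s0.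
have bound (p : density R d) : holder d s L p -> forall x, cube d x -> `|p x| <= L.
  by move=> Hp x cx; exact: holder_bound Hp cx.
have c0 c : 0 <= c -> 0 <= c * L / a ^+ 2.
  by move=> c_ge0; exact: (divr_ge0 (mulr_ge0 c_ge0 (ltW hL)) (sqr_ge0 a)).
rewrite (_ : 418 * L / a ^+ 2 = 64 * L / a ^+ 2 + 354 * L / a ^+ 2); last by lra.
rewrite EFinD; apply: leeD; apply: ge_ereal_sup => e [->|].
- by rewrite lee_fin; apply/c0/ler0n.
- by move=> [p Hp <-]; apply: type1_error => //; exact: bound.
- by rewrite lee_fin; apply/c0/ler0n.
- move=> [[p q] /= [Hp Hq pq] <-]; apply: type2_error => //.
  + exact: bound.
  + exact: bound.
  + by move=> ->; rewrite powR1 truncn1.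
  + exact: separated_bins eps_ge _ _ Hp Hq pq.
Qed.
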